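(* Let $b$, $k$ and $n$ be positive integers, let $g=\gcd(b,k)$ and $p=\frac{b+k}{g}$. Let $A=(a_{ij})$ be an $n\times n$ double band matrix, i.e. a real matrix such that $a_{ij}>0$ if $i-j=b$ or $i-j=-k$, and $a_{ij}=0$ otherwise. Write $n=mp+q$ with integers $m\ge 0$ and $0\le q<p$. (i) If $g=1$, then $A$ has a zero eigenvalue of multiplicity $q$, and $mp$ eigenvalues $$r_s\, e^{i2\pi j/p},\qquad j=0,\dots,p-1,\quad s=1,\dots,m,$$ where $r_1,\dots,r_m$ are distinct, real and positive. (ii) More generally (for arbitrary $g\ge 1$), the nonzero eigenvalues of $A$ are given by $$r_{s,t}\, e^{i2\pi j/p},\qquad j=0,\dots,p-1,\quad t=1,\dots,g,\quad s=1,\dots,\left\lfloor \frac{\left\lfloor \frac{n-t}{g}\right\rfloor+1}{p}\right\rfloor,$$ where for each fixed $t$ the numbers $r_{s,t}$ are distinct, real and positive. The zero eigenvalue of $A$ has multiplicity $$g\left(\left\lfloor \frac{n}{g}\right\rfloor \bmod p\right)+\left(n \bmod g\right)\left[\left(\left\lfloor \frac{n}{g}\right\rfloor+1\right)\bmod p-\left\lfloor \frac{n}{g}\right\rfloor \bmod p\right].$$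
   Context: In exponents $e^{i2\pi j/p}$, $i$ denotes the imaginary unit. For integers $x$ and $d\geq 1$, $x \bmod d$ denotes the remainder of $x$ in $\{0,1,\dots,d-1\}$; in the bracketed expression, $\left\lfloor n/g\right\rfloor \bmod p$ is the remainder of $\lfloor n/g\rfloor$ modulo $p$ and is subtracted from the remainder of $\lfloor n/g\rfloor+1$ modulo $p$. Eigenvalues are over $\mathbb{C}$ and the lists are counted with algebraic multiplicity (a multiplicity of zero means that $0$ is not an eigenvalue). An empty index range (e.g. $m=0$) means that there are no corresponding eigenvalues. *)

(* Defs.v *)
From mathcomp Require Import all_boot all_order all_algebra.
From mathcomp Require Import reals trigo.
From mathcomp Require Import complex.

Set Implicit Arguments.
Unset Strict Implicit.
Unset Printing Implicit Defensive.

Import Order.TTheory GRing.Theory Num.Theory.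
Local Open Scope ring_scope.
Local Open Scope complex_scope.

Definition double_band (R : realType) (b k n : nat) (A : 'M[R]_n) : Prop :=
  forall i j : 'I_n,
    let on_band := i%:Z - j%:Z = b%:Z \/ i%:Z - j%:Z = - k%:Z in
    (on_band -> 0 < A i j) /\ (~ on_band -> A i j = 0).

Definition alg_mult (R : realType) (n : nat) (A : 'M[R]_n) (z : R[i]) : nat :=
  mup z (char_poly (map_mx (real_complex R) A)).

(* [L] lists the nonzero complex eigenvalues of [A], each occurring as many
   times as its algebraic multiplicity. *)
Definition nonzero_eigenvalues (R : realType) (n : nat) (A : 'M[R]_n)
    (L : seq R[i]) : Prop :=
  0 \notin L /\ forall z : R[i], z != 0 -> count_mem z L = alg_mult A z.

(* e^(i theta), by Euler's formula *)
Definition expi (R : realType) (theta : R) : R[i] :=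
  cos theta +i* sin theta.

Definition unity_rot (R : realType) (p j : nat) : R[i] :=
  expi (2 * pi * j%:R / p%:R).

(* floor ((floor ((n - t) / g) + 1) / p). Since n - t may be negative, the
   divisions are those of [int], which are floors for positive divisors. The
   result is nonnegative when 1 <= n and 1 <= t <= g, and [absz] only casts it
   to [nat]. *)
Definition num_moduli (n g p t : nat) : nat :=
  `|((((n%:Z - t%:Z) %/ g%:Z)%Z + 1) %/ p%:Z)%Z|%N.

(* Main.v *)
Require Import Defs.
From mathcomp Require Import all_boot all_order all_algebra.
From mathcomp Require Import fingroup perm.
From mathcomp Require Import boolp reals trigo.
From mathcomp Require Import complex.
From mathcomp Require Import zify ring lra.

Set Implicit Arguments.
Unset Strict Implicit.
Unset Printing Implicit Defensive.

Import Order.TTheory GRing.Theory Num.Theory.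
Local Open Scope ring_scope.
Local Open Scope complex_scope.

(** Entries of [A] link only indices that are congruent modulo [g], so the
    characteristic polynomial of [A] is the product of those of [g] double band
    matrices, one for each residue class, with the coprime offsets [b / g] and
    [k / g] ([char_poly_residue]). It remains to treat [g = 1].

    Both bands satisfy [i - j = b] modulo [p = b + k]. As [b] is invertible
    modulo [p], conjugation by a diagonal matrix of [p]-th roots of unity
    multiplies [A] by a primitive one ([char_poly_graded]); so the
    characteristic polynomial is [X^q Q(X^p)] with [Q] of degree [m]. The whole
    statement is then that [Q] has [m] distinct positive roots. The class of
    [q] modulo [p] has exactly [m] elements below [n], and [A ^+ p] maps the
    row vectors supported there to one another. The [m] eigenvalues of this
    return map are [p]-th powers of eigenvalues of [A] ([eigen_pow_root]), so
    they are roots of [Q], and it suffices that they are positive and distinct.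

    This comes from counting sign changes. If [v] is supported on one class
    modulo [p], each entry of [v *m A] is a combination with positive
    coefficients of two neighbouring entries of [v] within that class. Hence
    [A] does not increase the number of sign changes ([strict_chain_step]).
    Better, if [v] lies in the class of [q] and is nonzero: the zeros of
    [v *m A ^+ n] may be given any signs, and still there
    are no more sign changes than in [v] ([weak_chain_iter],
    [weak_chain_strict]). A chain of signs is traced backwards, and a zero that
    never meets a nonzero ancestor would force a zero interval growing by one
    element per step, until [v = 0]. Nothing nonzero in the class of [q] is
    killed either: a kernel vector alternates too often ([orbit_neq0]).

    The number of sign changes is therefore a discrete Lyapunov function, which
    drops strictly at any vector whose first entry vanishes, since that entry
    can be given the sign that adds one change. Whatever returns to itself
    contradicts this: an eigenvector with first entry zero
    ([eigen_first_neq0]); a nonreal eigenvalue, through the recurrence of its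
    powers to the positive real direction ([complex_eigen_real]); a double
    eigenvalue, whose Jordan chain tends to the same eigenvector in the past and
    in the future ([simple_eigen]). A negative eigenvalue is excluded because
    the sign at the start of a longest chain is preserved
    ([real_eigen_gt0]). *)

Local Notation Re := complex.Re.
Local Notation Im := complex.Im.

(** * Alternating chains along a band *)

Section BandDynamics.
Variables (R : realFieldType) (n b k : nat).
Hypotheses (hb : (0 < b)%N) (hk : (0 < k)%N).
Implicit Types (v w : int -> R) (r : int) (e s : nat).

Definition in_class r (i : int) := exists z : int, i = r + z * (b + k)%:Z.

Definition on_class r v :=
  forall i, v i != 0 -> (0 <= i < n%:Z) /\ in_class r i.

Definition band_step v w := forall i : int, 0 <= i < n%:Z ->
  exists a c : R, [/\ 0 < a, 0 < c & w i = a * v (i - b%:Z) + c * v (i + k%:Z)].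

Definition strict_chain v e s := exists X : nat -> int,
  (forall j, (j < s)%N -> X j < X j.+1) /\
  (forall j, (j <= s)%N -> 0 < (-1) ^+ (e + j) * v (X j)).

(** The entries of a weak chain may vanish. The index [d] counts the steps by
    which it has been traced backwards: an entry that is still zero after [d]
    steps lies in an interval of zeros that has grown by at least one element
    at both ends in each step, so that it contains every position
    from [n - d] to [d]. *)
Definition weak_chain d r v e s := exists X : nat -> int,
  (forall j, (j < s)%N -> X j < X j.+1) /\
  (forall j, (j <= s)%N ->
    [/\ 0 <= X j < n%:Z, in_class r (X j), 0 <= (-1) ^+ (e + j) * v (X j)
      & v (X j) = 0 -> exists lo hi : int,
          [/\ lo <= X j <= hi, lo <= n%:Z - d%:Z, d%:Z <= hi
            & forall y : int, lo <= y <= hi -> v y = 0]]).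

Lemma in_class_gap r i j : in_class r i -> in_class r j -> i < j ->
  i + (b + k)%:Z <= j.
Proof.
move=> [x ->] [y ->]; rewrite ltrD2l ltr_pM2r; last by lia.
by move=> lt_xy; nia.
Qed.

Lemma in_class_subl r i : in_class (r + b%:Z) i -> in_class r (i - b%:Z).
Proof. by move=> [x ->]; exists x; lia. Qed.

Lemma in_class_addr r i : in_class (r + b%:Z) i -> in_class r (i + k%:Z).
Proof. by move=> [x ->]; exists (x + 1); lia. Qed.

Lemma signed_pos_combo (a c x y : R) (u : nat) : 0 < a -> 0 < c ->
  0 <= (-1) ^+ u * (a * x + c * y) ->
  [\/ 0 < (-1) ^+ u * x, 0 < (-1) ^+ u * y | x = 0 /\ y = 0].
Proof.
move=> a0 c0; rewrite -signr_odd; case: (odd u); rewrite /= ?expr1 ?expr0 => h.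
  have [x0|x0] := ltrP x 0; first by constructor 1; lra.
  have [y0|y0] := ltrP y 0; first by constructor 2; lra.
  by constructor 3; split; nra.
have [x0|x0] := ltrP 0 x; first by constructor 1; lra.
have [y0|y0] := ltrP 0 y; first by constructor 2; lra.
by constructor 3; split; nra.
Qed.

(** A nonzero entry of [w] has an ancestor of the same sign among its two
    neighbours in [v]. The neighbours of successive positions overlap in at
    most one position, which cannot carry both signs, so the chosen ancestors
    are again increasing. *)
Lemma strict_chain_step r v w e s : band_step v w ->
  on_class r v -> on_class (r + b%:Z) w ->
  strict_chain w e s -> strict_chain v e s.
Proof.
move=> hvw hv hw [X [Xmono Xpos]].
pose Y j := if 0 < (-1) ^+ (e + j) * v (X j - b%:Z) then X j - b%:Z
            else X j + k%:Z.
have Xcl j : (j <= s)%N -> 0 <= X j < n%:Z /\ in_class (r + b%:Z) (X j).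
  move=> js; apply: hw; apply: contraTneq (Xpos _ js) => ->.
  by rewrite mulr0 ltxx.
have Ypos j : (j <= s)%N -> 0 < (-1) ^+ (e + j) * v (Y j).
  move=> js; have [Xr _] := Xcl _ js.
  have [a [c [a0 c0 wE]]] := hvw _ Xr.
  have := Xpos _ js; rewrite wE /Y => h; case: ifP => // hn.
  have [] := signed_pos_combo a0 c0 (ltW h); rewrite ?hn //.
  by move=> [x0 y0]; move: h; rewrite x0 y0 !mulr0 addr0 mulr0 ltxx.
exists Y; split=> // j js.
have h1 := Ypos j (ltnW js); have h2 := Ypos j.+1 js.
have := in_class_gap (Xcl _ (ltnW js)).2 (Xcl _ js).2 (Xmono _ js).
have : Y j != Y j.+1.
  apply: contraTneq h1 => ->; rewrite -leNgt.
  by move: h2; rewrite addnS exprS mulN1r mulNr oppr_gt0 => /ltW.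
by rewrite /Y; do 2 case: ifP => _; move=> /eqP; lia.
Qed.

(** As soon as [v] vanishes at the two positions above [x], each zero of [w]
    next to [x] propagates the zeros of [v] by one more class element. *)
Lemma zero_interval_step r v w (x lo hi : int) : band_step v w ->
  on_class r v -> in_class (r + b%:Z) x -> 0 <= x < n%:Z ->
  lo <= x <= hi -> (forall y : int, lo <= y <= hi -> w y = 0) ->
  v (x - b%:Z) = 0 -> v (x + k%:Z) = 0 ->
  forall y : int, lo - b%:Z <= y <= hi + k%:Z -> v y = 0.
Proof.
move=> hvw hv [z xE] xr xlh w0 vxb vxk.
have out i : ~ (0 <= i < n%:Z) -> v i = 0.
  by have [//|/hv[]] := eqVneq (v i) 0.
have up (j : nat) : x + j%:Z * (b + k)%:Z <= hi ->
    v (x + j%:Z * (b + k)%:Z + k%:Z) = 0.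
  elim: j => [|j IH] hj; first by rewrite mul0r addr0.
  have IHj := IH ltac:(nia).
  have [yn|yn] := ltrP (x + j.+1%:Z * (b + k)%:Z) n%:Z; last by apply: out; nia.
  have [a [c [a0 c0]]] := hvw (x + j.+1%:Z * (b + k)%:Z) ltac:(nia).
  rewrite w0; last by nia.
  have -> : x + j.+1%:Z * (b + k)%:Z - b%:Z = x + j%:Z * (b + k)%:Z + k%:Z by lia.
  rewrite IHj mulr0 add0r => /esym/eqP.
  by rewrite mulf_eq0 gt_eqF //= => /eqP.
have down (j : nat) : lo <= x - j%:Z * (b + k)%:Z ->
    v (x - j%:Z * (b + k)%:Z - b%:Z) = 0.
  elim: j => [|j IH] hj; first by rewrite mul0r subr0.
  have IHj := IH ltac:(nia).
  have [yn|yn] := lerP 0 (x - j.+1%:Z * (b + k)%:Z); last by apply: out; nia.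
  have [a [c [a0 c0]]] := hvw (x - j.+1%:Z * (b + k)%:Z) ltac:(nia).
  rewrite w0; last by nia.
  have -> : x - j.+1%:Z * (b + k)%:Z + k%:Z = x - j%:Z * (b + k)%:Z - b%:Z by lia.
  rewrite IHj mulr0 addr0 => /esym/eqP.
  by rewrite mulf_eq0 gt_eqF //= => /eqP.
move=> y yr; apply/eqP; apply: contraT => vy.
have [yn [z' yE]] := hv _ vy.
have [zz|zz] := lerP z' z.
  have := down (absz (z - z')%R); have -> : (absz (z - z')%R)%:Z = z - z' by lia.
  have -> : x - (z - z') * (b + k)%:Z - b%:Z = y by lia.
  by move=> h; rewrite h ?eqxx // in vy; lia.
have := up (absz (z' - z - 1)%R).
have -> : (absz (z' - z - 1)%R)%:Z = z' - z - 1 by lia.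
have -> : x + (z' - z - 1) * (b + k)%:Z + k%:Z = y by lia.
by move=> h; rewrite h ?eqxx // in vy; lia.
Qed.


(** A position with two zero ancestors has no preferred one. Going left exactly
    when [v] has a nonzero entry further to the left keeps the chosen positions
    increasing, and between [0] and [n] because [v != 0]. *)
Lemma weak_chain_step d r v w e s : band_step v w ->
  on_class r v -> on_class (r + b%:Z) w -> (exists i, v i != 0) ->
  weak_chain d (r + b%:Z) w e s -> weak_chain d.+1 r v e s.
Proof.
move=> hvw hv hw [i0 vi0] [X [Xmono Xweak]].
pose before (x : int) := [exists i : 'I_n, (i%:Z < x) && (v i%:Z != 0)].
pose Y j := if 0 < (-1) ^+ (e + j) * v (X j - b%:Z) then X j - b%:Z
            else if 0 < (-1) ^+ (e + j) * v (X j + k%:Z) then X j + k%:Z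
            else if before (X j - b%:Z) then X j - b%:Z else X j + k%:Z.
have YE j : Y j = X j - b%:Z \/ Y j = X j + k%:Z.
  by rewrite /Y; case: ifP => _; [left|case: ifP => _; [right|case: ifP; auto]].
have Ycl j : (j <= s)%N -> in_class r (Y j).
  move=> /Xweak [_ Xc _ _].
  by case: (YE j) => ->; [apply: in_class_subl|apply: in_class_addr].
have Ycase j : (j <= s)%N -> 0 < (-1) ^+ (e + j) * v (Y j) \/
    [/\ v (X j - b%:Z) = 0, v (X j + k%:Z) = 0, w (X j) = 0
      & Y j = if before (X j - b%:Z) then X j - b%:Z else X j + k%:Z].
  move=> js; have [Xr _ Xs _] := Xweak _ js.
  have [a [c [a0 c0 wE]]] := hvw _ Xr.
  move: Xs; rewrite /Y wE => /(signed_pos_combo a0 c0).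
  case: ifP => [|n1]; first by left.
  case: ifP => [|n2]; first by left.
  case=> [|//|[x0 y0]]; rewrite ?n1 //.
  by right; rewrite x0 y0 !mulr0 addr0.
have Yrange j : (j <= s)%N -> 0 <= Y j < n%:Z.
  move=> js; have [Xr Xc _ _] := Xweak _ js.
  have [Ypos|[vb vk _ ->]] := Ycase _ js.
    by apply: (hv _ _).1; apply: contraTneq Ypos => ->; rewrite mulr0 ltxx.
  case: ifP => [/existsP[i /andP[ix _]]|/negbT/existsPn nb]; first by lia.
  have [i0r i0c] := hv _ vi0.
  have i0n : (absz i0 < n)%N by lia.
  have /nandP := nb (Ordinal i0n); rewrite /= gez0_abs; last by lia.
  rewrite vi0; case=> //; rewrite -leNgt => le_i0.
  have neb : i0 != X j - b%:Z by apply: contraNneq vi0 => ->; apply/eqP.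
  have nek : i0 != X j + k%:Z by apply: contraNneq vi0 => ->; apply/eqP.
  have lt_i0 : X j - b%:Z < i0 by rewrite lt_neqAle eq_sym neb.
  have := in_class_gap (in_class_subl Xc) i0c lt_i0.
  by move/eqP in nek; lia.
exists Y; split=> [j js|j js].
  have js' := ltnW js.
  have [X1r X1c _ _] := Xweak _ js'; have [X2r X2c _ _] := Xweak _ js.
  have gap := in_class_gap X1c X2c (Xmono _ js).
  have [//|Yle] := ltrP (Y j) (Y j.+1).
  have Y1E : Y j = X j + k%:Z by case: (YE j) (YE j.+1) => [] h1 [] h2; lia.
  have Y2E : Y j.+1 = X j + k%:Z by case: (YE j) (YE j.+1) => [] h1 [] h2; lia.
  have X2E : X j.+1 - b%:Z = X j + k%:Z by case: (YE j.+1) => h2; lia.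
  have [p1|[vb1 vk1 _ D1]] := Ycase _ js'.
    have [p2|[vb2 _ _ _]] := Ycase _ js.
      by move: p1 p2; rewrite Y1E Y2E addnS exprS mulN1r mulNr oppr_gt0 => /lt_gtF ->.
    by move: p1; rewrite Y1E -X2E vb2 mulr0 ltxx.
  have [p2|[_ _ _ D2]] := Ycase _ js.
    by move: p2; rewrite Y2E vk1 mulr0 ltxx.
  move: D2; case: ifP => [/existsP[i /andP[ix vi]] _|_]; last by lia.
  move: D1; case: ifP => [_|/negbT/existsPn/(_ i)]; first by lia.
  rewrite vi andbT -leNgt => le_i _.
  have neb : i%:Z != X j - b%:Z by apply: contraNneq vi => ->; apply/eqP.
  have lt_i : X j - b%:Z < i%:Z by rewrite lt_neqAle eq_sym neb.
  have := in_class_gap (in_class_subl X1c) (hv _ vi).2 lt_i.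
  by lia.
have [Xr Xc _ Xz] := Xweak _ js.
split; [exact: Yrange|exact: Ycl| |].
  by have [/ltW//|[vb vk _ _]] := Ycase _ js; case: (YE j) => ->;
     rewrite ?vb ?vk mulr0.
move=> vY; have [|[vb vk wX _]] := Ycase _ js; first by rewrite vY mulr0 ltxx.
have [lo [hi [lohi lo_n d_hi wz]]] := Xz wX.
exists (lo - b%:Z), (hi + k%:Z); split; try by lia.
  by case: (YE j) => ->; lia.
exact: (zero_interval_step hvw hv Xc Xr lohi wz vb vk).
Qed.

Lemma weak_chain_strict d r v e s : (n <= d)%N -> on_class r v ->
  (exists i, v i != 0) -> weak_chain d r v e s -> strict_chain v e s.
Proof.
move=> nd hv [i vi] [X [Xmono Xweak]]; exists X; split=> // j /Xweak[_ _ Xs Xz].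
rewrite lt_def Xs mulf_neq0 ?signr_eq0 //; apply/eqP => /Xz[lo [hi [_ lo0 nhi vz]]].
by have [ir _] := hv _ vi; move: vi; rewrite vz ?eqxx //; lia.
Qed.

Lemma weak_chain0 r v e s (X : nat -> int) :
  (forall j, (j < s)%N -> X j < X j.+1) ->
  (forall j, (j <= s)%N ->
    [/\ 0 <= X j < n%:Z, in_class r (X j) & 0 <= (-1) ^+ (e + j) * v (X j)]) ->
  weak_chain 0 r v e s.
Proof.
move=> Xm Xp; exists X; split=> // j /Xp[Xr Xc Xs]; split=> // vX.
exists (X j), (X j); split=> [|||y]; try by lia.
by move=> /le_anti E; rewrite -E.
Qed.

(** Each vanishing entry of [w] at a position with two ancestors forces
    opposite signs on them. At a position with one ancestor it would force a
    zero, which spreads to the whole class; so such positions do not occur, and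
    this makes the class long enough for [m] changes of sign. *)
Lemma kernel_strict_chain m r v w : (m * (b + k) <= n)%N ->
  on_class r v -> (exists i, v i != 0) -> band_step v w -> (forall i, w i = 0) ->
  exists e, strict_chain v e m.
Proof.
move=> hm hv [i0 vi0] hvw w0.
(* [d] is the first element of the class *)
pose d := (r %% (b + k)%:Z)%Z.
have p0 : 0 < (b + k)%:Z by lia.
have d0 : 0 <= d by rewrite modz_ge0; lia.
have dp : d < (b + k)%:Z by apply: ltz_pmod.
have out i : ~ (0 <= i < n%:Z) -> v i = 0.
  by have [//|/hv[]] := eqVneq (v i) 0.
have rel i : 0 <= i < n%:Z -> exists2 c, c < 0 & v (i + k%:Z) = c * v (i - b%:Z).
  move=> /hvw[a [c [a0 c0]]]; rewrite w0 => /esym/eqP.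
  rewrite addrC addr_eq0 => /eqP h; exists (- (a / c)).
    by rewrite oppr_lt0 divr_gt0.
  by apply: (mulfI (lt0r_neq0 c0)); rewrite h; field; rewrite lt0r_neq0.
have [j0 i0E] : exists j : nat, i0 = d + j%:Z * (b + k)%:Z.
  have [i0r [z i0E]] := hv _ vi0.
  have := divz_eq r (b + k)%:Z; rewrite -/d; set t := (r %/ (b + k)%:Z)%Z => rE.
  have tz : 0 <= t + z by nia.
  by exists (absz (t + z)%R); rewrite gez0_abs //; lia.
have vd : v d != 0.
  apply: contraNneq vi0 => vd; rewrite i0E; apply/eqP; elim: j0 {i0E} => [|j IH].
    by rewrite mul0r addr0.
  have [h|h] := ltrP (d + j%:Z * (b + k)%:Z + b%:Z) n%:Z; last by apply: out; nia.
  have [c _] := rel (d + j%:Z * (b + k)%:Z + b%:Z) ltac:(nia).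
  rewrite addrK IH mulr0 => <-; congr v; lia.
have dn := (hv _ vd).1.
have dk : d < k%:Z.
  rewrite ltNge; apply/negP => kd.
  have [c _] := rel (d - k%:Z) ltac:(lia).
  by rewrite subrK (out (_ - b%:Z)) ?mulr0 => [/eqP|]; [rewrite (negPf vd)|lia].
have [e ve] : exists e : nat, 0 < (-1) ^+ e * v d.
  have [v0|v0] := ltrP 0 (v d); first by exists 0%N; rewrite mul1r.
  by exists 1%N; rewrite expr1 mulN1r oppr_gt0 lt_neqAle vd.
exists e, (fun j => d + j%:Z * (b + k)%:Z); split=> j js; first by nia.
elim: j js => [|j IH] js; first by rewrite mul0r addr0 addn0.
have IHj := IH (ltnW js).
have jn : 0 <= d + j%:Z * (b + k)%:Z < n%:Z.
  by apply: (hv _ _).1; apply: contraTneq IHj => ->; rewrite mulr0 ltxx.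
have [c c0] := rel (d + j%:Z * (b + k)%:Z + b%:Z) ltac:(nia).
rewrite addrK => vE.
have -> : d + j.+1%:Z * (b + k)%:Z = d + j%:Z * (b + k)%:Z + b%:Z + k%:Z by lia.
rewrite vE addnS exprS mulN1r mulNr mulrCA -mulNr mulr_gt0 //; lra.
Qed.

(** The class of [q] has only [m] elements below [n]. *)
Lemma strict_chain_bound m q r v e s : n = (m * (b + k) + q)%N ->
  (q < b + k)%N -> in_class q%:Z r -> on_class r v -> strict_chain v e s ->
  (s < m)%N.
Proof.
move=> hn hq [z0 rE] hv [X [Xmono Xpos]].
have Xcl j : (j <= s)%N -> 0 <= X j < n%:Z /\ in_class r (X j).
  move=> js; apply: hv; apply: contraTneq (Xpos _ js) => ->.
  by rewrite mulr0 ltxx.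
have XE j : (j <= s)%N -> q%:Z + j%:Z * (b + k)%:Z <= X j.
  elim: j => [|j IH] js.
    have [h [z E]] := Xcl 0%N js; have : 0 <= z0 + z by nia.
    by nia.
  have := in_class_gap (Xcl _ (ltnW js)).2 (Xcl _ js).2 (Xmono _ js).
  by have := IH (ltnW js); lia.
have := XE _ (leqnn s); have [h _] := Xcl _ (leqnn s).
by move=> h'; rewrite ltnNge; apply/negP => ms; nia.
Qed.

End BandDynamics.

(** * Sign alternation of row vectors *)

Section Alternation.
Variables (R : realFieldType) (m : nat).
Implicit Types (u w : 'rV[R]_m) (e s : nat).

Definition alternates u e s := exists X : nat -> 'I_m,
  (forall j, (j < s)%N -> (X j < X j.+1)%N) /\
  (forall j, (j <= s)%N -> 0 < (-1) ^+ (e + j) * u 0 (X j)).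

Definition weakly_alternates u e s := exists X : nat -> 'I_m,
  (forall j, (j < s)%N -> (X j < X j.+1)%N) /\
  (forall j, (j <= s)%N -> 0 <= (-1) ^+ (e + j) * u 0 (X j)).

Lemma alternates_bound u e s : alternates u e s -> (s < m)%N.
Proof.
move=> [X [Xm _]]; apply: leq_ltn_trans (ltn_ord (X s)).
suff h j : (j <= s)%N -> (j <= X j)%N by exact: h.
elim: j => // j IH js; exact: leq_ltn_trans (IH (ltnW js)) (Xm _ js).
Qed.

Lemma alternates_unbounded u :
  ~ (forall s, exists e, alternates u e s).
Proof. by move=> /(_ m)[e /alternates_bound]; rewrite ltnn. Qed.

Lemma alternates0 u : u != 0 -> exists e, alternates u e 0.
Proof.
move=> /rV0Pn[x ux]; have [ux0|ux0] := ltrP 0 (u 0 x).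
  by exists 0%N, (fun=> x); split=> // -[] // _; rewrite mul1r.
exists 1%N, (fun=> x); split=> // -[] // _.
by rewrite expr1 mulN1r oppr_gt0 lt_neqAle ux.
Qed.

(** Strict alternation is an open condition; where [u] vanishes the signs of
    [w] are free, whence the weak alternation in the next lemma. *)
Lemma alternates_near u w e s :
  (forall x, u 0 x != 0 -> 0 < u 0 x * w 0 x) ->
  alternates u e s -> alternates w e s.
Proof.
move=> near [X [Xm Xp]]; exists X; split=> // j /Xp h.
have ux : u 0 (X j) != 0 by apply: contraTneq h => ->; rewrite mulr0 ltxx.
by rewrite -(pmulr_rgt0 _ h) mulrACA -expr2 sqrr_sign mul1r near.
Qed.

Lemma weakly_alternates_near u w e s :
  (forall x, u 0 x != 0 -> 0 < u 0 x * w 0 x) ->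
  alternates w e s -> weakly_alternates u e s.
Proof.
move=> near [X [Xm Xp]]; exists X; split=> // j /Xp h.
have [->|ux] := eqVneq (u 0 (X j)) 0; first by rewrite mulr0.
by rewrite ltW // -(pmulr_rgt0 _ h) mulrC mulrACA -expr2 sqrr_sign mul1r near.
Qed.

Lemma alternatesN u e s : alternates u e s -> alternates (- u) e.+1 s.
Proof.
move=> [X [Xm Xp]]; exists X; split=> // j /Xp.
by rewrite mxE addSn exprS mulN1r mulrNN.
Qed.

Lemma weakly_alternatesN u e s :
  weakly_alternates u e s -> weakly_alternates (- u) e.+1 s.
Proof.
move=> [X [Xm Xp]]; exists X; split=> // j /Xp.
by rewrite mxE addSn exprS mulN1r mulrNN.
Qed.

Lemma alternatesZ a u e s : 0 < a -> alternates u e s -> alternates (a *: u) e s.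
Proof.
move=> a0 [X [Xm Xp]]; exists X; split=> // j /Xp h.
by rewrite mxE mulrCA pmulr_rgt0.
Qed.

Lemma weakly_alternatesZ a u e s : a != 0 ->
  weakly_alternates u e s -> exists e', weakly_alternates (a *: u) e' s.
Proof.
wlog a0 : a u e / 0 < a => [wl an h|_ [X [Xm Xp]]].
  have [a0|a0] := ltrP 0 a; first exact: (wl _ _ _ a0 an h).
  have := wl (- a) (- u) e.+1; rewrite scaleNr scalerN opprK; apply.
  - by rewrite oppr_gt0 lt_neqAle an.
  - by rewrite oppr_eq0.
  - exact: weakly_alternatesN.
by exists e, X; split=> // j /Xp h; rewrite mxE mulrCA mulr_ge0 // ltW.
Qed.

End Alternation.

(** A zero first entry can be read with the sign opposite to that of the next
    entry of the chain. *)
Lemma weakly_alternates_cons (R : realFieldType) m (u : 'rV[R]_m.+1) e s :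
  u 0 0 = 0 -> alternates u e s -> weakly_alternates u e.+1 s.+1.
Proof.
move=> u0 [X [Xm Xp]]; exists (fun j => if j is j'.+1 then X j' else ord0).
split=> [[_|j /Xm//]|[_|j /Xp/ltW]]; last 2 first.
- by rewrite u0 mulr0.
- by rewrite addSnnS -addSnnS addSn addnS !exprS mulrA mulrNN !mul1r.
rewrite lt0n; apply: contraTneq (Xp 0%N isT) => X0.
by rewrite (_ : X 0%N = 0) ?u0 ?mulr0 ?ltxx //; apply: val_inj.
Qed.

(** * Repeated eigenvalues and recurrence of powers *)

Lemma char_poly_similar (F : fieldType) n (P M C : 'M[F]_n) :
  P \in unitmx -> P *m M = C *m P -> char_poly M = char_poly C.
Proof.
move=> Pu PM; have : \det (map_mx polyC P) != 0.
  by rewrite det_map_mx polyC_eq0 -unitfE -unitmxE.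
move=> d0; apply: (mulfI d0); rewrite [RHS]mulrC /char_poly -!det_mulmx.
congr (\det _); rewrite /char_poly_mx mulmxBr mulmxBl -!map_mxM PM.
by rewrite scalar_mxC.
Qed.

(** In a basis starting with an eigenvector [u], the matrix is block triangular,
    and a second root [a] comes from an eigenvector of the quotient by [u]. The
    case [eps = 0] is that of two independent eigenvectors, the case
    [eps != 0] that of a Jordan chain. *)
Lemma double_root_chain (F : fieldType) m (M : 'M[F]_m) a :
  ('X - a%:P) ^+ 2 %| char_poly M ->
  exists (u w : 'rV[F]_m) eps, [/\ u != 0, u *m M = a *: u,
     w *m M = a *: w + eps *: u & forall c, w != c *: u].
Proof.
move=> dvd2.
have : root (char_poly M) a.
  by rewrite -dvdp_XsubCl; apply: dvdp_trans dvd2; rewrite expr2 dvdp_mulr.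
rewrite -eigenvalue_root_char => /eigenvalueP[u uM u0].
case: m => [|m] in M dvd2 u uM u0 *.
  by move: u0; rewrite (thinmx0 u) eqxx.
pose P : 'M_(1 + m) := row_ebase u.
have Pu : P \in unitmx by exact: row_ebase_unit.
pose e1 : 'rV[F]_(1 + m) := row_mx 1%:M 0.
have [k k0 uE] : exists2 k, k != 0 & u = k *: (e1 *m P).
  have := mulmx_ebase u; rewrite rank_rV u0 [col_ebase u]mx11_scalar.
  rewrite (_ : pid_mx _ = e1); last first.
    apply/rowP=> j; rewrite !mxE; case: splitP => j' jE.
      by rewrite !mxE !ord1 /= jE !ord1.
    by rewrite !mxE jE.
  move=> <-; exists (col_ebase u 0 0); last by rewrite -mulmxA mul_scalar_mx.
  have := col_ebase_unit u; rewrite unitmxE [X in \det X]mx11_scalar.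
  by rewrite det_scalar1 unitfE.
pose C : 'M_(1 + m) := P *m M *m invmx P.
have e1C : e1 *m C = a *: e1.
  have ekP : (k *: e1) *m P = u by rewrite -scalemxAl -uE.
  apply: (scalerI k0); rewrite scalemxAl /C !mulmxA ekP uM -ekP.
  by rewrite -scalemxAl mulmxK // scalerA mulrC -scalerA.
have CE : C = block_mx a%:M 0 (dlsubmx C) (drsubmx C).
  rewrite -[LHS]submxK; move: e1C.
  rewrite -{1}[C]submxK /e1 mul_row_block !mul1mx !mul0mx !addr0 scale_row_mx scaler0.
  move=> /eq_row_mx[ulE urE].
  by rewrite ulE urE scalemx1.
have chiC : char_poly M = ('X - a%:P) * char_poly (drsubmx C).
  have -> : char_poly M = char_poly C.
    by apply: (char_poly_similar Pu); rewrite /C mulmxKV.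
  rewrite [in LHS]CE /char_poly /char_poly_mx map_block_mx map_scalar_mx map_mx0.
  rewrite (scalar_mx_block 1 m) opp_block_mx add_block_mx oppr0 addr0.
  by rewrite det_lblock det_mx11 !mxE eqxx !mulr1n.
have : root (char_poly (drsubmx C)) a.
  by rewrite -dvdp_XsubCl -(dvdp_mul2l _ _ (negbT (polyXsubC_eq0 a))) -chiC -expr2.
rewrite -eigenvalue_root_char => /eigenvalueP[u' u'C u'0].
pose w := row_mx (0 : 'M_1) u' *m P.
exists u, w, ((u' *m dlsubmx C) 0 0 / k); split=> //.
- have -> : w *m M = row_mx 0 u' *m C *m P by rewrite /C /w -!mulmxA mulVmx // mulmx1.
  rewrite {1}CE mul_row_block !mul0mx add0r u'C add0r.
  rewrite uE scalerA divfK // /w /e1 !scalemxAl -mulmxDl; congr (_ *m _).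
  rewrite !scale_row_mx add_row_mx !scaler0 add0r addr0; congr row_mx.
  by rewrite [LHS]mx11_scalar scalemx1.
move=> c; apply: contraNneq u'0; rewrite /w uE scalerA scalemxAl.
move=> /(can_inj (mulmxK Pu)); rewrite scale_row_mx scaler0 => /eq_row_mx[_ ->].
exact: eqxx.
Qed.

Lemma pigeonhole_pair (c1 c2 : nat -> nat) K :
  (forall j, (c1 j < K)%N) -> (forall j, (c2 j < K)%N) ->
  exists j l, [/\ (j < l)%N, c1 j = c1 l & c2 j = c2 l].
Proof.
move=> c1K c2K.
pose f (j : 'I_(K * K).+1) := (Ordinal (c1K j), Ordinal (c2K j)).
have : ~~ injectiveb f.
  apply/negP => /injectiveP /leq_card.
  by rewrite card_prod !card_ord ltnn.
move=> /injectivePn[j [l jl [e1 e2]]].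
by case: (ltngtP j l) jl => [h|h|/val_inj->]; rewrite ?eqxx //;
  [exists j, l|exists l, j].
Qed.

Lemma close_of_truncn (R : archiRealFieldType) (x y L : R) :
  0 < L -> -1 <= x -> -1 <= y ->
  Num.truncn ((x + 1) * L) = Num.truncn ((y + 1) * L) -> `|x - y| < L^-1.
Proof.
move=> L0 x1 y1 E.
have := truncn_itv (_ : 0 <= (x + 1) * L); have := truncn_itv (_ : 0 <= (y + 1) * L).
rewrite E; move=> /(_ ltac:(nra))/andP[a1 a2] /(_ ltac:(nra))/andP[b1 b2].
rewrite -(ltr_pM2r L0) mulVf ?gt_eqF // -[X in _ * X](gtr0_norm L0) -normrM.
by rewrite ltr_norml; apply/andP; split; move: a2 b2; rewrite -!natr1; lra.
Qed.

(** Dirichlet's pigeonhole argument: two powers of [mu] have nearly the same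
    direction, so their quotient nearly points along the positive real axis. The
    conclusion is invariant under scaling, so that [mu] need not be on the unit
    circle. *)
Lemma power_recurrence (R : realType) (mu : R[i]) (d : R) : mu != 0 -> 0 < d ->
  exists k, [/\ (0 < k)%N, 0 < Re (mu ^+ k) & `|Im (mu ^+ k)| <= d * Re (mu ^+ k)].
Proof.
move=> mu0 d0.
pose N j := Num.sqrt (Re (mu ^+ j) ^+ 2 + Im (mu ^+ j) ^+ 2).
have sq0 j : 0 < Re (mu ^+ j) ^+ 2 + Im (mu ^+ j) ^+ 2.
  have := expf_neq0 j mu0; case: (mu ^+ j) => x y; rewrite eq_complex /= => h.
  rewrite lt_def addr_ge0 ?sqr_ge0 // andbT paddr_eq0 ?sqr_ge0 //.
  by rewrite !sqrf_eq0.
have N0 j : 0 < N j by rewrite sqrtr_gt0.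
pose a j := Re (mu ^+ j) / N j; pose c j := Im (mu ^+ j) / N j.
have ac1 j : a j ^+ 2 + c j ^+ 2 = 1.
  rewrite !expr_div_n -mulrDl sqr_sqrtr ?divff ?gt_eqF // ltW //.
have abd (x y : R) : x ^+ 2 + y ^+ 2 = 1 -> -1 <= x <= 1 by move=> h; nra.
have a1 j : -1 <= a j <= 1 by exact: abd (ac1 j).
have c1 j : -1 <= c j <= 1 by apply: (abd _ (a j)); rewrite addrC.
(* [1 / L] is smaller than both [1 / 2] and [d / 4] *)
pose L := (Num.truncn (d^-1 * 4 + 2)).+1.
have LP : d^-1 * 4 + 2 < L%:R.
  have h0 : 0 <= d^-1 * 4 + 2 by rewrite addr_ge0 // mulr_ge0 // invr_ge0 ltW.
  by have /andP[] := truncn_itv h0.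
have L0 : 0 < L%:R :> R by rewrite ltr0n.
have tr (x : R) : -1 <= x <= 1 -> (Num.truncn ((x + 1) * L%:R) < (2 * L).+1)%N.
  move=> /andP[x1 x2]; rewrite ltnS -(ler_nat R).
  apply: le_trans (_ : (x + 1) * L%:R <= _); first by rewrite truncn_le; nra.
  by rewrite natrM; nra.
have [j [l [jl e1 e2]]] := pigeonhole_pair (fun j => tr _ (a1 j)) (fun j => tr _ (c1 j)).
have [/andP[aj _] /andP[al _]] := conj (a1 j) (a1 l).
have [/andP[cj _] /andP[cl _]] := conj (c1 j) (c1 l).
have da := close_of_truncn L0 aj al e1.
have dc := close_of_truncn L0 cj cl e2.
exists (l - j)%N; rewrite subn_gt0 jl.
have muE : mu ^+ l = mu ^+ (l - j) * mu ^+ j by rewrite -exprD subnK // ltnW.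
have ReE : Re (mu ^+ (l - j)) = N l / N j * (a l * a j + c l * c j).
  have hN : N j ^+ 2 = Re (mu ^+ j) ^+ 2 + Im (mu ^+ j) ^+ 2.
    by rewrite sqr_sqrtr // ltW.
  have -> : N l / N j * (a l * a j + c l * c j) =
     (Re (mu ^+ l) * Re (mu ^+ j) + Im (mu ^+ l) * Im (mu ^+ j)) / N j ^+ 2.
    by rewrite /a /c; field; rewrite !gt_eqF.
  apply: (canRL (mulfK _)); first by rewrite gt_eqF // hN.
  rewrite hN muE; case: (mu ^+ (l - j)) => x y; case: (mu ^+ j) => z t /=.
  by rewrite /=; ring.
have ImE : Im (mu ^+ (l - j)) = N l / N j * (c l * a j - a l * c j).
  have hN : N j ^+ 2 = Re (mu ^+ j) ^+ 2 + Im (mu ^+ j) ^+ 2.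
    by rewrite sqr_sqrtr // ltW.
  have -> : N l / N j * (c l * a j - a l * c j) =
     (Im (mu ^+ l) * Re (mu ^+ j) - Re (mu ^+ l) * Im (mu ^+ j)) / N j ^+ 2.
    by rewrite /a /c; field; rewrite !gt_eqF.
  apply: (canRL (mulfK _)); first by rewrite gt_eqF // hN.
  rewrite hN muE; case: (mu ^+ (l - j)) => x y; case: (mu ^+ j) => z t /=.
  by rewrite /=; ring.
have q0 : 0 < N l / N j by rewrite divr_gt0.
set x := a j - a l in da; set y := c j - c l in dc.
have Li2 : L%:R^-1 < 1 / 2 :> R.
  rewrite mul1r ltf_pV2 ?posrE //; apply: le_lt_trans LP.
  by rewrite lerDr mulr_ge0 // invr_ge0 ltW.
have Lid : L%:R^-1 < d / 4 :> R.
  rewrite -[d / 4]invrK ltf_pV2 ?posrE ?invr_gt0 ?divr_gt0 //.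
  by rewrite invf_div; apply: le_lt_trans LP; rewrite mulrC lerDl.
have cosE : a l * a j + c l * c j = 1 - (x ^+ 2 + y ^+ 2) / 2.
  by have := ac1 j; have := ac1 l; rewrite /x /y => h1 h2; lra.
have sinE : c l * a j - a l * c j = c l * x - a l * y by rewrite /x /y; ring.
have x2 : x ^+ 2 <= 1 / 4 by rewrite -real_normK ?num_real //; have := normr_ge0 x; nra.
have y2 : y ^+ 2 <= 1 / 4 by rewrite -real_normK ?num_real //; have := normr_ge0 y; nra.
have cos2 : 1 / 2 <= a l * a j + c l * c j by rewrite cosE; lra.
rewrite ReE ImE; split=> //; first by rewrite pmulr_rgt0 //; lra.
rewrite normrM (gtr0_norm q0) [d * _]mulrCA (ler_pM2l q0).
have : `|c l * a j - a l * c j| <= d / 2.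
  rewrite sinE (le_trans (ler_normB _ _)) // (normrM (c l)) (normrM (a l)).
  have hc : `|c l| <= 1 by rewrite ler_norml; exact: c1.
  have ha : `|a l| <= 1 by rewrite ler_norml; exact: a1.
  have hx : `|c l| * `|x| <= `|x| by rewrite ler_piMl.
  have hy : `|a l| * `|y| <= `|y| by rewrite ler_piMl.
  apply: le_trans (lerD hx hy) _; apply: le_trans (lerD (ltW da) (ltW dc)) _.
  by move: Lid; set Li := _^-1 => Lid; lra.
by move=> h; nra.
Qed.

(** * Spectrum of a matrix that diminishes sign alternation *)

Lemma dominating_nat (R : realType) (I : finType) (f g : I -> R) :
  exists N : nat, forall x, g x != 0 -> `|f x| < N%:R * `|g x|.
Proof.
pose S := \sum_x `|f x| / `|g x|.
have S0 : 0 <= S by apply: sumr_ge0 => x _; rewrite divr_ge0.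
exists (Num.truncn S).+1 => x gx; rewrite -ltr_pdivrMr ?normr_gt0 //.
have /andP[_] := truncn_itv S0; apply: le_lt_trans.
by rewrite /S (bigD1 x) //= lerDl; apply: sumr_ge0 => y _; rewrite divr_ge0.
Qed.

(** A matrix satisfying the three hypotheses behaves like an oscillatory matrix
    in the sense of Gantmacher and Krein: its spectrum is simple and positive. *)
Section Spectrum.
Variables (R : realType) (m : nat) (M : 'M[R]_m.+1) (T : nat).
Hypothesis T_gt0 : (0 < T)%N.
Hypothesis M_vd : forall u e s, alternates (u *m M) e s -> alternates u e s.
Hypothesis M_strict : forall u e s, u != 0 ->
  weakly_alternates (u *m M ^+ T) e s -> alternates u e s.
Hypothesis M_inj : forall u : 'rV_m.+1, u *m M = 0 -> u = 0.

Lemma vd_iter t (u : 'rV_m.+1) e s : alternates (u *m M ^+ t) e s -> alternates u e s.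
Proof.
elim: t e => [|t IH] e; first by rewrite expr0 mulmx1.
by rewrite exprSr -mulmxE mulmxA => /M_vd /IH.
Qed.

Lemma eigen_iter t (u : 'rV_m.+1) a : u *m M = a *: u -> u *m M ^+ t = a ^+ t *: u.
Proof.
move=> uM; elim: t => [|t IH]; first by rewrite expr0 mulmx1 scale1r.
by rewrite exprSr -mulmxE mulmxA IH -scalemxAl uM scalerA exprSr.
Qed.

(** An eigenvector is its own image under [M ^+ T] up to a factor, so that its
    weak and strict numbers of sign changes coincide. *)
Lemma eigen_weak_strict (u : 'rV_m.+1) a e s : u != 0 -> u *m M = a *: u ->
  weakly_alternates u e s -> exists e', alternates u e' s.
Proof.
move=> u0 uM wu; have a0 : a != 0.
  by apply: contraNneq u0 => a0; apply/eqP/M_inj; rewrite uM a0 scale0r.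
have [e' h] := weakly_alternatesZ (expf_neq0 T a0) wu.
by exists e'; apply: M_strict; rewrite // (eigen_iter T uM).
Qed.

Lemma eigen_first_neq0 (u : 'rV_m.+1) a : u != 0 -> u *m M = a *: u -> u 0 0 != 0.
Proof.
move=> u0 uM; apply/eqP => u00; apply: (@alternates_unbounded _ _ u).
elim=> [|s [e ue]]; first exact: alternates0.
exact: eigen_weak_strict u0 uM (weakly_alternates_cons u00 ue).
Qed.

(** If [a < 0], the vector [u] has chains of any attained length starting with
    either sign. Of two such chains one starts further to the left, and its
    first position extends the other one. *)
Lemma real_eigen_gt0 (u : 'rV_m.+1) a : u != 0 -> u *m M = a *: u -> 0 < a.
Proof.
move=> u0 uM; have a0 : a != 0.
  by apply: contraNneq u0 => a0; apply/eqP/M_inj; rewrite uM a0 scale0r.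
rewrite lt_def a0 leNgt; apply/negP => an.
have flip e s : alternates u e s -> alternates u e.+1 s.
  move=> /alternatesN ue; apply: M_vd; rewrite uM -[a]opprK scaleNr -scalerN.
  by apply: alternatesZ; rewrite // oppr_gt0.
apply: (@alternates_unbounded _ _ u); elim=> [|s [e ue]]; first exact: alternates0.
wlog: e ue / exists X Y : nat -> 'I_m.+1,
  [/\ forall j, (j < s)%N -> (Y j < Y j.+1)%N,
      forall j, (j <= s)%N -> 0 < (-1) ^+ (e.+1 + j) * u 0 (Y j),
      0 < (-1) ^+ e * u 0 (X 0%N) & (X 0%N < Y 0%N)%N].
  move=> wl; have [Y [Ym Yp]] := flip _ _ ue; have [X [Xm Xp]] := ue.
  have X0 := Xp 0%N isT; have Y0 := Yp 0%N isT; rewrite !addn0 in X0 Y0.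
  case: (ltngtP (X 0%N) (Y 0%N)) => [lt|lt|/val_inj E].
  - by apply: (wl e) => //; exists X, Y.
  - apply: (wl e.+1); first exact: flip.
    exists Y, X; split=> // j /Xp.
    by rewrite !addSn !exprS !mulN1r opprK.
  - by move: X0 Y0; rewrite E exprS mulN1r mulNr oppr_gt0 => /lt_gtF->.
move=> [X [Y [Ym Yp X0 XY]]]; exists e.
exists (fun j => if j is j'.+1 then Y j' else X 0%N); split.
  by case=> // j /Ym.
by case=> [_|j /Yp]; [rewrite addn0|rewrite addSnnS].
Qed.

(** After normalising [w] to have first entry zero, [M ^+ t] acts on [w] as
    [w + t *: v] up to a positive factor, for [v] an eigenvector and for
    negative [t] as well. Both for large and for very negative [t] this is
    close to a multiple of [v], whose strict and weak numbers of sign changes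
    agree, so the number of sign changes cannot drop in between. But it does
    drop at [t = 0]. When [eps = 0], the vector [w] itself is an eigenvector
    with first entry zero. *)
Lemma simple_eigen a : ~~ (('X - a%:P) ^+ 2 %| char_poly M).
Proof.
apply/negP => /double_root_chain[u [w' [eps [u0 uM wM' wu']]]].
have a0 : 0 < a by exact: real_eigen_gt0 uM.
have u00 := eigen_first_neq0 u0 uM.
pose w := w' - (w' 0 0 / u 0 0) *: u.
have w00 : w 0 0 = 0 by rewrite !mxE divfK // subrr.
have w0 : w != 0.
  by apply: contraNneq (wu' (w' 0 0 / u 0 0)) => /eqP; rewrite subr_eq0.
have wM : w *m M = a *: w + eps *: u.
  rewrite mulmxBl wM' -scalemxAl uM scalerBr !scalerA [_ * a]mulrC.
  by rewrite addrAC.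
have [eps0|eps0] := eqVneq eps 0.
  suff : w 0 0 != 0 by rewrite w00 eqxx.
  by apply: (@eigen_first_neq0 w a w0); rewrite wM eps0 scale0r addr0.
move: w w00 w0 wM => w w00 w0 wM {w' wM' wu'}.
(* the rescaled eigenvector [v] satisfies [w *m M = a *: (w + v)] *)
pose v := (eps / a) *: u.
have v0 : v != 0.
  by rewrite scaler_eq0 negb_or u0 andbT mulf_neq0 // invr_eq0 gt_eqF.
have vM : v *m M = a *: v by rewrite -scalemxAl uM !scalerA mulrC.
have wvM : w *m M = a *: (w + v).
  by rewrite wM scalerDr scalerA mulrC divfK ?gt_eqF.
move: v v0 vM wvM => v v0 vM wvM.
have orbit c t : (w + c *: v) *m M ^+ t = a ^+ t *: (w + (c + t%:R) *: v).
  elim: t => [|t IH]; first by rewrite expr0 mulmx1 scale1r addr0.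
  rewrite exprSr -mulmxE mulmxA IH -scalemxAl mulmxDl wvM -scalemxAl vM.
  rewrite scalerA [_ * a]mulrC -scalerA -scalerDr scalerA -exprSr.
  congr (_ *: _); rewrite -natr1 [in RHS]addrA [in RHS]scalerDl scale1r.
  by rewrite addrA -!addrA [v + _]addrC.
have [N hN] := dominating_nat (fun x => w 0 x) (fun x => v 0 x).
(* a multiple of [T]: the last [T] of the [t] steps gain the sign change *)
pose t := (T * N.+1)%N.
have ht x : v 0 x != 0 -> `|w 0 x| < t%:R * `|v 0 x|.
  move=> vx; apply: lt_le_trans (hN _ vx) _.
  rewrite ler_wpM2r // ler_nat /t.
  by rewrite (leq_trans (leqnSn N)) // leq_pmull.
have near_plus x : v 0 x != 0 -> 0 < v 0 x * (w + t%:R *: v) 0 x.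
  move=> vx; rewrite !mxE; have := ht _ vx.
  rewrite ltr_norml; case: (ltrgtP (v 0 x) 0) vx => // hv _ /andP[h1 h2].
    by rewrite ltr0_norm // in h1 h2; rewrite nmulr_rgt0 //; lra.
  by rewrite gtr0_norm // in h1 h2; rewrite pmulr_rgt0 //; lra.
have near_minus x : v 0 x != 0 -> 0 < v 0 x * - (w - t%:R *: v) 0 x.
  move=> vx; rewrite !mxE; have := ht _ vx.
  rewrite ltr_norml; case: (ltrgtP (v 0 x) 0) vx => // hv _ /andP[h1 h2].
    by rewrite ltr0_norm // in h1 h2; rewrite nmulr_rgt0 //; lra.
  by rewrite gtr0_norm // in h1 h2; rewrite pmulr_rgt0 //; lra.
apply: (@alternates_unbounded _ _ w).
elim=> [|s [e we]]; first exact: alternates0.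
have back : alternates (w - t%:R *: v) e.+1 s.+1.
  apply: (@vd_iter (T * N)); rewrite -scaleNr orbit.
  have -> : - t%:R + (T * N)%:R = - T%:R :> R.
    by rewrite /t mulnS natrD; ring.
  apply: alternatesZ; first by rewrite exprn_gt0.
  apply: M_strict.
    apply: contraNneq w0 => h; apply/eqP.
    have := orbit (- T%:R) T; rewrite h mul0mx addNr scale0r addr0.
    by move=> /esym/eqP; rewrite scaler_eq0 expf_eq0 gt_eqF // andbF => /eqP.
  rewrite orbit addNr scale0r addr0.
  have [X [Xm Xp]] := weakly_alternates_cons w00 we.
  exists X; split=> // j /Xp h; rewrite mxE mulrCA mulr_ge0 //.
  by rewrite exprn_ge0 // ltW.
have [e1 ve1] : exists e', alternates v e' s.+1.
  apply: (eigen_weak_strict v0 vM); apply: weakly_alternates_near (alternatesN back).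
  by move=> x /near_minus; rewrite [in X in _ -> X]mxE.
exists e1; apply: (@vd_iter t).
have := orbit 0 t; rewrite scale0r addr0 add0r => ->.
apply: alternatesZ; first by rewrite exprn_gt0.
exact: alternates_near ve1.
Qed.

Local Notation toC := (real_complex R).
(* For an eigenvector [z] with eigenvalue [mu], the real dynamics of [M] on the
   plane spanned by its real and imaginary parts is [c |-> c * mu]. *)
Let rot (z : 'rV[R[i]]_m.+1) (c : R[i]) : 'rV[R]_m.+1 := \row_x Re (c * z 0 x).

Lemma rot_step z mu c : z *m map_mx toC M = mu *: z ->
  rot z c *m M = rot z (c * mu).
Proof.
move=> zM; apply/rowP=> x; rewrite !mxE.
have -> : c * mu * z 0 x = \sum_y c * z 0 y * (M y x)%:C.
  have /rowP/(_ x) := zM; rewrite !mxE => zMx.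
  by rewrite -mulrA -zMx mulr_sumr; apply: eq_bigr => y _; rewrite !mxE mulrA.
rewrite (raddf_sum (@complex.Re R : Rcomplex R -> R)).
apply: eq_bigr => y _; rewrite !mxE.
by case: (c * z 0 y) => p q /=; rewrite mulr0 subr0.
Qed.

Lemma rot_iter z mu c t : z *m map_mx toC M = mu *: z ->
  rot z c *m M ^+ t = rot z (c * mu ^+ t).
Proof.
move=> zM; elim: t => [|t IH]; first by rewrite !expr0 mulmx1 mulr1.
by rewrite exprSr -mulmxE mulmxA IH (rot_step _ zM) -mulrA -exprSr.
Qed.

(** Choose [c] such that the real vector [rot z c] has first entry zero. If it is
    nonzero, it has fewer sign changes than its preimage under [M ^+ T], that
    is [rot z (c * mu ^- T)]. By recurrence of the powers of [mu ^+ T], a later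
    image has the same signs as this preimage: a contradiction. *)
Lemma complex_eigen_real (z : 'rV[R[i]]_m.+1) mu : z != 0 ->
  z *m map_mx toC M = mu *: z -> Im mu = 0.
Proof.
move=> z0 zM.
have rot0 c : rot z c = 0 -> rot z (c * 'i) = 0 -> c = 0.
  move=> /rowP h1 /rowP h2; apply/eqP; apply: contraNT z0 => c0.
  apply/eqP/rowP => x; rewrite mxE; apply: (mulfI c0); rewrite mulr0.
  have := h1 x; have := h2 x; rewrite !mxE mulrAC.
  case: (c * z 0 x) => p q /=.
  by rewrite mulr0 mulr1 add0r => /eqP; rewrite oppr_eq0 => /eqP-> ->.
have mu0 : mu != 0.
  apply/eqP => mu0.
  have h c : rot z c = 0.
    apply: M_inj; rewrite (rot_step _ zM) mu0 mulr0.
    by apply/rowP=> x; rewrite !mxE mul0r.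
  by have /eqP := rot0 1 (h _) (h _); rewrite oner_eq0.
have [c c0 hc] : exists2 c, c != 0 & rot z c 0 0 = 0.
  have [z00|z00] := eqVneq (z 0 0) 0.
    by exists 1; rewrite ?oner_eq0 // mxE z00 mulr0.
  exists ('i * (z 0 0)^-1); last by rewrite mxE divfK.
  by rewrite mulf_neq0 ?invr_eq0 // eq_complex /= oner_eq0 andbF.
have [rc0|rc] := eqVneq (rot z c) 0.
  (* [c *: z] is then ['i] times a real vector, so [mu] is a quotient of reals *)
  have [x hx] : exists x, rot z (c * 'i) 0 x != 0.
    by apply/rV0Pn; apply: contraNneq c0 => h; rewrite (rot0 c rc0 h).
  have := rot_step c zM; rewrite rc0 mul0mx => /rowP/(_ x).
  have /rowP/(_ x) := rc0; move: hx; rewrite !mxE.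
  have -> : c * mu * z 0 x = c * z 0 x * mu by rewrite mulrAC.
  have -> : c * 'i * z 0 x = c * z 0 x * 'i by rewrite mulrAC.
  case: (c * z 0 x) (mu) => p q [p' q'] /=.
  rewrite mulr0 mulr1 sub0r oppr_eq0 => hq ->; rewrite mul0r sub0r => /esym/eqP.
  by rewrite oppr_eq0 mulf_eq0 (negPf hq) => /eqP.
have [N hN] := dominating_nat (fun x => Im (c * mu ^- T * z 0 x))
                              (fun x => Re (c * mu ^- T * z 0 x)).
have N0 : 0 < (N.+1%:R)^-1 :> R by rewrite invr_gt0 ltr0n.
have [k [k0 Rek Imk]] := power_recurrence (expf_neq0 T mu0) N0.
rewrite -exprM in Rek Imk.
exfalso; apply: (@alternates_unbounded _ _ (rot z c)).
elim=> [|s [e re]]; first exact: alternates0.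
have prevE : rot z (c * mu ^- T) *m M ^+ T = rot z c.
  by rewrite (rot_iter _ _ zM) divfK // expf_neq0.
have alt_prev : alternates (rot z (c * mu ^- T)) e.+1 s.+1.
  apply: M_strict; last by rewrite prevE; exact: weakly_alternates_cons.
  by apply: contraNneq rc => h; rewrite -prevE h mul0mx.
(* [T * k.-1] steps after [rot z c] the signs are those of [T] steps before *)
exists e.+1; apply: (@vd_iter (T * k.-1)); rewrite (rot_iter _ _ zM).
apply: alternates_near alt_prev => x; rewrite !mxE => hx.
have -> : c * mu ^+ (T * k.-1) * z 0 x = mu ^+ (T * k) * (c * mu ^- T * z 0 x).
  have -> : (T * k = T * k.-1 + T)%N by rewrite -{1}(prednK k0) mulnS addnC.
  by rewrite exprD; field; rewrite expf_neq0.
have := hN x hx; move: hx Rek Imk.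
case: (mu ^+ (T * k)) => p q; case: (c * _ * _) => y t /= y0 p0 hq ht.
have hq' : N.+1%:R * `|q| <= p.
  by rewrite -ler_pdivlMl ?ltr0n.
have : `|q * t| < p * `|y|.
  have y0' : 0 < `|y| by rewrite normr_gt0.
  rewrite normrM; apply: le_lt_trans (_ : `|q| * (N%:R * `|y|) < _).
    by rewrite ler_wpM2l // ltW.
  rewrite mulrA ltr_pM2r // mulrC.
  have [->|q0] := eqVneq q 0; first by rewrite normr0 mulr0.
  apply: lt_le_trans hq'; rewrite ltr_pM2r ?normr_gt0 // ltr_nat //.
have -> : y * (p * y - q * t) = p * y ^+ 2 - y * (q * t) by ring.
move=> h; rewrite subr_gt0; apply: le_lt_trans (ler_norm _) _.
have -> : p * y ^+ 2 = p * `|y| * `|y|.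
  by rewrite -mulrA -expr2 real_normK ?num_real.
by rewrite normrM mulrC ltr_pM2r // normr_gt0.
Qed.

Theorem char_poly_simple_positive : exists rs : seq R,
  [/\ uniq rs, all (fun a => 0 < a) rs
    & char_poly M = \prod_(a <- rs) ('X - a%:P)].
Proof.
have [cs csE] := closed_field_poly_normal (map_poly toC (char_poly M)).
rewrite (monicP (monic_map _ (char_poly_monic M))) scale1r in csE.
have cs_root c : c \in cs -> c = (Re c)%:C.
  move=> cin; have : root (char_poly (map_mx toC M)) c.
    by rewrite -map_char_poly csE root_prod_XsubC.
  rewrite -eigenvalue_root_char => /eigenvalueP[z zM z0].
  by have := complex_eigen_real z0 zM; case: c {cin zM} => x y /= ->.
have chiE : char_poly M = \prod_(a <- map (@complex.Re R) cs) ('X - a%:P).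
  apply: (map_poly_inj toC); rewrite csE rmorph_prod big_map.
  rewrite !big_seq; apply: eq_bigr => c cin.
  by rewrite rmorphB /= map_polyX map_polyC /= -cs_root.
exists (map (@complex.Re R) cs); split=> //.
  apply: count_mem_uniq => a; have := simple_eigen a.
  rewrite -mup_geq ?monic_neq0 ?char_poly_monic // chiE mu_prod_XsubC -ltnNge.
  by rewrite -has_pred1 has_count; case: count => [|[]].
apply/allP => a ain; have : root (char_poly M) a by rewrite chiE root_prod_XsubC.
rewrite -eigenvalue_root_char => /eigenvalueP[u uM u0].
exact: real_eigen_gt0 u0 uM.
Qed.

End Spectrum.

(** * Orbits of a double band matrix *)

Section Extension.
Variables (R : realFieldType) (n : nat).
Implicit Types v : 'rV[R]_n.

(** Extension by zero to all integers removes the special cases at the two ends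
    of the index range. *)
Definition ext v (z : int) : R :=
  if z is Posz i then (if insub i is Some j then v 0 j else 0) else 0.

Lemma ext_ord v (i : 'I_n) : ext v (i : nat)%:Z = v 0 i.
Proof. by rewrite /ext valK. Qed.

Lemma ext_range v z : ext v z != 0 -> 0 <= z < n%:Z.
Proof.
case: z => [i|i] /=; last by rewrite eqxx.
by case: insubP => [j ij _|]; rewrite ?eqxx.
Qed.

Lemma ext_neq0 v : v != 0 -> exists i, ext v i != 0.
Proof. by move=> /rV0Pn[i vi]; exists (i : nat)%:Z; rewrite ext_ord. Qed.

Lemma ext0 i : ext 0 i = 0.
Proof. by case: i => //= i; case: insubP => // j _ _; rewrite mxE. Qed.

Lemma sum_at v (A : 'M[R]_n) (j : 'I_n) (z : int) :
  (forall i : 'I_n, (i : nat)%:Z = z -> 0 < A i j) ->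
  exists2 a, 0 < a & \sum_(i < n | (i : nat)%:Z == z) v 0 i * A i j = a * ext v z.
Proof.
move=> Apos; have [zr|zr] := boolP (0 <= z < n%:Z).
  case: z zr Apos => [z|//] zr Apos; have zn : (z < n)%N by lia.
  exists (A (Ordinal zn) j); first exact: Apos.
  rewrite (ext_ord v (Ordinal zn)) mulrC (big_pred1 (Ordinal zn)) //.
exists 1 => //; rewrite big_pred0 => [|i].
  by have [->|/ext_range] := eqVneq (ext v z) 0; rewrite ?mulr0 // (negPf zr).
by apply/negP => /eqP E; move: (ltn_ord i) zr; rewrite -E; lia.
Qed.

End Extension.

Section Band.
Variables (R : realType) (b k n : nat) (A : 'M[R]_n).
Hypotheses (hb : (0 < b)%N) (hk : (0 < k)%N) (hA : double_band b k A).

(** Column [j] of [A] has its entries in rows [j - k] and [j + b]; hence the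
    offsets [b] and [k] trade places in the row action. *)
Lemma double_band_step (v : 'rV_n) : band_step n k b (ext v) (ext (v *m A)).
Proof.
case=> [j|j] // jr; have jn : (j < n)%N by lia.
have [i h|a a0 aE] := @sum_at _ _ v A (Ordinal jn) (j%:Z - k%:Z).
  by apply: (hA _ _).1; right; rewrite h /=; lia.
have [i h|c c0 cE] := @sum_at _ _ v A (Ordinal jn) (j%:Z + b%:Z).
  by apply: (hA _ _).1; left; rewrite h /=; lia.
exists a, c; split=> //; rewrite -aE -cE (ext_ord _ (Ordinal jn)) mxE.
rewrite [in RHS]big_mkcond [X in _ + X]big_mkcond -big_split; apply: eq_bigr => i _ /=.
have [h1|h1] := eqVneq; have [h2|h2] := eqVneq; rewrite ?addr0 ?add0r //.
  by lia.
by rewrite (hA i (Ordinal jn)).2 ?mulr0 // => -[] /= h;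
  move/eqP in h1; move/eqP in h2; lia.
Qed.

Lemma on_class_band r (v : 'rV_n) : on_class n k b r (ext v) ->
  on_class n k b (r + k%:Z) (ext (v *m A)).
Proof.
move=> hv i vi; have ir := ext_range vi; split=> //.
have [a [c [a0 c0 E]]] := double_band_step v ir.
have [h|h] := eqVneq (ext v (i - k%:Z)) 0.
  have [h'|/hv[_ [z zE]]] := eqVneq (ext v (i + b%:Z)) 0.
    by move: vi; rewrite E h h' !mulr0 addr0 eqxx.
  by exists (z - 1); lia.
by have [_ [z zE]] := hv _ h; exists z; lia.
Qed.

Lemma on_class_iter r (v : 'rV_n) t : on_class n k b r (ext v) ->
  on_class n k b (r + t%:Z * k%:Z) (ext (v *m A ^+ t)).
Proof.
elim: t => [|t IH] hv; first by rewrite expr0 mulmx1 mul0r addr0.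
rewrite exprSr -mulmxE mulmxA.
have -> : r + t.+1%:Z * k%:Z = r + t%:Z * k%:Z + k%:Z by lia.
exact/on_class_band/IH.
Qed.

Lemma strict_chain_iter r (v : 'rV_n) t e s : on_class n k b r (ext v) ->
  strict_chain (ext (v *m A ^+ t)) e s -> strict_chain (ext v) e s.
Proof.
elim: t => [|t IH] hv; first by rewrite expr0 mulmx1.
rewrite exprSr -mulmxE mulmxA => h; apply: IH => //.
have hv' := @on_class_iter _ _ t hv.
exact: (strict_chain_step hk hb (double_band_step _) hv' (on_class_band hv') h).
Qed.

Lemma weak_chain_iter r (v : 'rV_n) t d e s :
  (forall j, v *m A ^+ j != 0) -> on_class n k b r (ext v) ->
  weak_chain n k b d (r + t%:Z * k%:Z) (ext (v *m A ^+ t)) e s ->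
  weak_chain n k b (t + d) r (ext v) e s.
Proof.
move=> v0 hv; elim: t d => [|t IH] d; first by rewrite expr0 mulmx1 mul0r addr0.
rewrite exprSr -mulmxE mulmxA => h; rewrite addSnnS; apply: IH.
have hv' := @on_class_iter _ _ t hv.
apply: (weak_chain_step hk hb (double_band_step _) hv' (on_class_band hv')).
  exact: ext_neq0 (v0 t).
by have <- : r + t.+1%:Z * k%:Z = r + t%:Z * k%:Z + k%:Z by lia.
Qed.

Variables (m q : nat) (hn : n = (m * (b + k) + q)%N) (hq : (q < b + k)%N).

(** A vector about to be killed has [m] sign changes by
    [kernel_strict_chain]. So has then its ancestor in the class of [q], which
    is too short for that. *)
Lemma orbit_neq0 (v : 'rV_n) t : on_class n k b q%:Z (ext v) -> v != 0 ->
  v *m A ^+ t != 0.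
Proof.
move=> hv v0; elim: t => [|t IH]; first by rewrite expr0 mulmx1.
rewrite exprSr -mulmxE mulmxA; apply/negP => /eqP h.
have hv' := @on_class_iter _ _ t hv.
have hm : (m * (k + b) <= n)%N by rewrite hn [(k + b)%N]addnC leq_addr.
have [|e ch] := kernel_strict_chain hk hb hm hv' (ext_neq0 IH) (double_band_step _).
  by move=> i; rewrite h ext0.
have hn' : n = (m * (k + b) + q)%N by rewrite hn [(b + k)%N]addnC.
have hq' : (q < k + b)%N by rewrite addnC.
have cq : in_class k b q%:Z q%:Z by exists 0; rewrite mul0r addr0.
have := strict_chain_bound hk hb hn' hq' cq hv (strict_chain_iter hv ch).
by rewrite ltnn.
Qed.

End Band.

(** * Rotational symmetry of the spectrum *)

(** Conjugation by the diagonal matrix of the [w ^+ h i] turns [A] into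
    [w *: A]. *)
Lemma char_poly_graded (F : fieldType) n (A : 'M[F]_n) p (w : F) (h : 'I_n -> nat) :
  p.-primitive_root w -> (forall i j, A i j != 0 -> w ^+ h i = w * w ^+ h j) ->
  forall i, (char_poly A)`_i != 0 -> i = n %[mod p].
Proof.
move=> wp hA i ci0.
have w0 : w != 0.
  apply: contra_eq_neq (prim_expr_order wp) => ->.
  by rewrite expr0n gtn_eqF ?(prim_order_gt0 wp) // eq_sym oner_eq0.
pose D : 'M[F]_n := diag_mx (\row_i w ^+ h i).
have Du : D \in unitmx.
  rewrite unitmxE det_diag unitfE; apply/prodf_neq0 => j _.
  by rewrite mxE expf_neq0.
have DA : D *m A = (w *: A) *m D.
  rewrite mul_diag_mx mul_mx_diag; apply/matrixP => x y; rewrite !mxE.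
  have [->|Axy] := eqVneq (A x y) 0; first by rewrite !mulr0 mul0r.
  by rewrite (hA _ _ Axy) mulrAC.
have E : char_poly (w *: A) \Po (w *: 'X) = w ^+ n *: char_poly A.
  rewrite /char_poly -det_map_mx -[RHS]mul_polyC polyC_exp -detZ; congr (\det _).
  apply/matrixP => x y; rewrite !mxE /= comp_polyB raddfMn /= comp_polyX comp_polyC.
  by rewrite mulrBr -mul_polyC mulrnAr polyCM.
have coefE (q : {poly F}) : (q \Po (w *: 'X))`_i = w ^+ i * q`_i.
  elim/poly_ind: q i {ci0} => [|q c IH] [|i]; rewrite ?comp_poly0 ?coef0 ?mulr0 //.
    rewrite comp_poly_MXaddC !coefD !coefC -scalerAr coefZ !coefMX /=.
    by rewrite mulr0 !add0r mul1r.
  rewrite comp_poly_MXaddC !coefD !coefC -scalerAr coefZ !coefMX /= !addr0 IH.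
  by rewrite mulrA -exprS.
have /(congr1 (fun q : {poly F} => q`_i)) := E.
rewrite coefE coefZ -(char_poly_similar Du DA) => /(mulIf ci0)/eqP.
by rewrite (eq_prim_root_expr wp) => /eqP.
Qed.

(** [A ^+ p - a] is singular and factors as the product of the [A - c]. *)
Lemma eigen_pow_root (F : fieldType) n (A : 'M[F]_n) p a (v : 'rV_n) s :
  v != 0 -> v *m A ^+ p = a *: v -> 'X^p - a%:P = \prod_(c <- s) ('X - c%:P) ->
  exists2 c, c \in s & root (char_poly A) c.
Proof.
case: n => [|n] in A v *; first by rewrite (thinmx0 v) eqxx.
move=> v0 vA sE.
have : \det (A ^+ p - a%:M) == 0.
  apply/det0P; exists v => //.
  by rewrite mulmxBr vA mul_mx_scalar subrr.
have -> : A ^+ p - a%:M = \prod_(c <- s) (A - c%:M).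
  have := congr1 (horner_mx A) sE; rewrite rmorphB rmorphXn rmorph_prod /=.
  rewrite horner_mx_X horner_mx_C => ->; apply: eq_bigr => c _.
  by rewrite rmorphB /= horner_mx_X horner_mx_C.
elim: s {sE} => [|c s IH]; first by rewrite big_nil det1 oner_eq0.
rewrite big_cons -mulmxE det_mulmx mulf_eq0 => /orP[/det0P[u u0 uA]|/IH[d ds dA]].
  exists c; first exact: mem_head.
  rewrite -eigenvalue_root_char; apply/eigenvalueP; exists u => //.
  by apply/eqP; rewrite -subr_eq0 -mul_mx_scalar -mulmxBr uA.
by exists d; rewrite // in_cons ds orbT.
Qed.

Lemma prod_rotations (F : fieldType) p (w l : F) : p.-primitive_root w -> l != 0 ->
  'X^p - (l ^+ p)%:P = \prod_(c <- [seq l * w ^+ j | j <- iota 0 p]) ('X - c%:P).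
Proof.
move=> wp l0; have p0 := prim_order_gt0 wp.
rewrite [LHS](@all_roots_prod_XsubC _ _ [seq l * w ^+ j | j <- iota 0 p]).
- by rewrite lead_coefDl ?lead_coefXn ?scale1r // size_polyXn size_polyN ltnS
     (leq_trans (size_polyC_leq1 _)).
- by rewrite size_XnsubC // size_map size_iota.
- apply/allP => _ /mapP[j _ ->]; rewrite rootE !hornerE exprMn.
  by rewrite -exprM mulnC exprM (prim_expr_order wp) expr1n mulr1 subrr.
rewrite uniq_rootsE map_inj_in_uniq ?iota_uniq // => i j.
rewrite !mem_iota /= => hi hj /(mulfI l0)/eqP.
by rewrite (eq_prim_root_expr wp) !modn_small // => /eqP.
Qed.

Section Rotations.
Variable R : realType.

Lemma expiD (x y : R) : expi (x + y) = expi x * expi y.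
Proof.
by rewrite /expi cosD sinD [sin x * _ + _]addrC.
Qed.

Lemma unity_rotE p j : unity_rot R p j = unity_rot R p 1 ^+ j.
Proof.
rewrite /unity_rot; elim: j => [|j IH].
  by rewrite mulr0 mul0r /expi cos0 sin0.
by rewrite exprS -IH -expiD; congr expi; rewrite -natr1; ring.
Qed.

(** If the order were [d < p], then [cos (2 y) = 1] for [y = pi * d / p], which
    lies strictly between [0] and [pi], where [sin] is positive. *)
Lemma unity_rot_prim p : (0 < p)%N -> p.-primitive_root (unity_rot R p 1).
Proof.
move=> p0; have pn0 : p%:R != 0 :> R by rewrite pnatr_eq0 -lt0n.
have wp : unity_rot R p 1 ^+ p = 1.
  by rewrite -unity_rotE /unity_rot mulfK // mulr_natl /expi cos2pi sin2pi.
have [d dprim dp] := prim_order_exists p0 wp.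
suff dE : d = p by move: dprim; rewrite dE.
apply/eqP; rewrite eqn_leq dvdn_leq //= leqNgt; apply/negP => ltdp.
have := prim_expr_order dprim; rewrite -unity_rotE /unity_rot.
set y : R := pi * d%:R / p%:R.
have -> : 2 * pi * d%:R / p%:R = y *+ 2 by rewrite -mulr_natl /y; field.
have y0 : 0 < y < pi.
  have pi0 := pi_gt0 R; have d0 := prim_order_gt0 dprim.
  rewrite divr_gt0 ?mulr_gt0 ?ltr0n //= ltr_pdivrMr ?ltr0n //.
  by rewrite ltr_pM2l // ltr_nat.
have := sin_gt0_pi y0; rewrite /expi => siny [].
rewrite cos_mulr2n => h _; have {}h : cos y ^+ 2 *+ 2 - 1 = 1 :> R := h.
by have := cos2Dsin2 y; nra.
Qed.

Lemma positive_root p (a : R) : (0 < p)%N -> 0 < a -> exists2 l : R, 0 < l & l ^+ p = a.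
Proof.
move=> p0 a0; have : 0 < p.-root (a%:C) by rewrite rootC_gt0 // ltcR.
have := rootCK p0 a%:C; case: (p.-root _) => x y E.
rewrite ltcE /= => /andP[/eqP y0 x0]; exists x => //.
apply: (@complexI R); rewrite rmorphXn -E /= y0.
by [].
Qed.

End Rotations.

(** * The return map to a residue class *)

Section ReturnMap.
Variables (R : realType) (b k m' q : nat).
Hypotheses (hb : (0 < b)%N) (hk : (0 < k)%N) (hq : (q < b + k)%N).
Let p := (b + k)%N.
Let m := m'.+1.
Let n := (m * p + q)%N.
Variable A : 'M[R]_n.
Hypothesis hA : double_band b k A.

Lemma class_pos_lt (x : 'I_m) : (q + x * p < n)%N.
Proof. by have := ltn_ord x; rewrite /n /p; nia. Qed.

Definition class_pos x : 'I_n := Ordinal (class_pos_lt x).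

Definition class_incl : 'M[R]_(m, n) := \matrix_(x, i) (i == class_pos x)%:R.

(** The matrix of [A ^+ p] acting on the row vectors supported on the class of
    [q] modulo [p]. That class is taken because it has exactly [m] elements
    below [n]. *)
Definition return_mx : 'M[R]_m := class_incl *m A ^+ p *m class_incl^T.

Lemma class_pos_inj : injective class_pos.
Proof. by move=> x y [E]; apply: val_inj => /=; rewrite /p in E; nia. Qed.

Lemma class_incl_pos (u : 'rV_m) x : (u *m class_incl) 0 (class_pos x) = u 0 x.
Proof.
rewrite mxE (bigD1 x) //= mxE eqxx mulr1 big1 ?addr0 // => y yx.
by rewrite mxE (inj_eq class_pos_inj) eq_sym (negPf yx) mulr0.
Qed.

Lemma class_restr (v : 'rV_n) x : (v *m class_incl^T) 0 x = v 0 (class_pos x).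
Proof.
rewrite mxE (bigD1 (class_pos x)) //= !mxE eqxx mulr1 big1 ?addr0 // => i ix.
by rewrite !mxE (negPf ix) mulr0.
Qed.

Lemma class_incl_out (u : 'rV_m) i :
  (forall x, i != class_pos x) -> (u *m class_incl) 0 i = 0.
Proof. by move=> hi; rewrite mxE big1 // => x _; rewrite mxE (negPf (hi x)) mulr0. Qed.

Lemma on_class_incl (u : 'rV_m) : on_class n k b q%:Z (ext (u *m class_incl)).
Proof.
move=> z vz; have zr := ext_range vz; split=> //.
case: z zr vz => // z zr; have zn : (z < n)%N by lia.
rewrite (ext_ord _ (Ordinal zn)).
have [/existsP[x /eqP/(congr1 val)/= zE] _|/existsPn hx] :=
  boolP [exists x, Ordinal zn == class_pos x]; last by rewrite class_incl_out ?eqxx.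
by exists (x : nat)%:Z; rewrite /p in zE; lia.
Qed.

Lemma class_restrK (v : 'rV_n) : on_class n k b q%:Z (ext v) ->
  v *m class_incl^T *m class_incl = v.
Proof.
move=> hv; apply/rowP => i.
have [/existsP[x /eqP->]|/existsPn hx] := boolP [exists x, i == class_pos x].
  by rewrite class_incl_pos class_restr.
rewrite class_incl_out //; apply/esym/eqP; rewrite -ext_ord.
have [//|/hv[ir [z zE]]] := eqVneq (ext v (i : nat)%:Z) 0.
have z0 : 0 <= z by nia.
have zm : (absz z < m)%N.
  rewrite -ltz_nat gez0_abs // -(@ltr_pM2r _ (k + b)%:Z); last by lia.
  by rewrite -(ltrD2l q%:Z) -zE addrC -PoszM -PoszD [(k + b)%N]addnC; case/andP: ir.
have /negP[] := hx (Ordinal zm); rewrite -val_eqE /= -eqz_nat PoszD PoszM gez0_abs //.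
by rewrite zE /p [(k + b)%N]addnC.
Qed.

Lemma class_incl_inj (u : 'rV_m) : u *m class_incl = 0 -> u = 0.
Proof. by move=> h; apply/rowP=> x; rewrite -class_incl_pos h !mxE. Qed.

Lemma on_class_return r (v : int -> R) t :
  on_class n k b (r + (p * t)%N%:Z * k%:Z) v <-> on_class n k b r v.
Proof.
split=> hv i /hv[ir [z zE]]; split=> //.
  by exists (z + t%:Z * k%:Z); rewrite /p in zE *; nia.
by exists (z - t%:Z * k%:Z); rewrite /p; nia.
Qed.

Lemma return_mxE (u : 'rV_m) :
  u *m return_mx *m class_incl = u *m class_incl *m A ^+ p.
Proof.
rewrite /return_mx !mulmxA class_restrK //.
rewrite -[p in A ^+ p]muln1; apply/(on_class_return _ _ 1)/on_class_iter => //.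
exact: on_class_incl.
Qed.

Lemma return_mx_iter (u : 'rV_m) t :
  u *m return_mx ^+ t *m class_incl = u *m class_incl *m A ^+ (p * t).
Proof.
elim: t => [|t IH]; first by rewrite muln0 !expr0 !mulmx1.
by rewrite exprSr -mulmxE mulmxA return_mxE IH mulnSr exprD -mulmxE mulmxA.
Qed.

Lemma ext_class (u : 'rV_m) (x : 'I_m) : ext (u *m class_incl) (q + x * p)%N%:Z = u 0 x.
Proof. by rewrite -(class_incl_pos u x) -ext_ord. Qed.

Lemma alternates_ext (u : 'rV_m) e s :
  alternates u e s <-> strict_chain (ext (u *m class_incl)) e s.
Proof.
split=> [[X [Xm Xp]]|[X [Xm Xp]]].
  exists (fun j => (q + X j * p)%N%:Z); split=> [j /Xm h|j /Xp h].
    by rewrite /p; nia.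
  by rewrite ext_class.
pose Y j : 'I_m := odflt ord0 [pick x : 'I_m | (q + x * p)%N%:Z == X j].
have YE j : (j <= s)%N -> X j = (q + Y j * p)%N%:Z.
  move=> /Xp h; rewrite /Y; case: pickP => [x /eqP//|/= nx].
  have ne : ext (u *m class_incl) (X j) != 0.
    by apply: contraTneq h => ->; rewrite mulr0 ltxx.
  have [Xr [z zE]] := on_class_incl ne.
  have z0 : 0 <= z by nia.
  have zm : (absz z < m)%N.
    rewrite -ltz_nat gez0_abs // -(@ltr_pM2r _ (k + b)%:Z); last by lia.
    by rewrite -(ltrD2l q%:Z) -zE addrC -PoszM -PoszD [(k + b)%N]addnC; case/andP: Xr.
  have /negP[] := nx (Ordinal zm); rewrite PoszD PoszM gez0_abs //.
  by rewrite zE /p [(k + b)%N]addnC.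
exists Y; split=> j js.
  by have := Xm _ js; rewrite (YE _ js) (YE _ (ltnW js)) /p; nia.
by have := Xp _ js; rewrite (YE _ js) ext_class.
Qed.

Lemma return_mx_vd (u : 'rV_m) e s :
  alternates (u *m return_mx) e s -> alternates u e s.
Proof.
move=> /alternates_ext; rewrite return_mxE => h; apply/alternates_ext.
exact: (strict_chain_iter hb hk hA (@on_class_incl u) h).
Qed.

Lemma return_orbit_neq0 (u : 'rV_m) t : u != 0 -> u *m class_incl *m A ^+ t != 0.
Proof.
move=> u0; apply: (@orbit_neq0 _ b k n A hb hk hA m q) => //.
  exact: on_class_incl.
by apply: contraNneq u0 => /class_incl_inj ->.
Qed.

Lemma return_mx_inj (u : 'rV_m) : u *m return_mx = 0 -> u = 0.
Proof.
move=> h; apply/eqP; apply: contraT => /(return_orbit_neq0 p).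
by rewrite -return_mxE h mul0mx eqxx.
Qed.

(** One application of the return map is [p] steps of [A]; already [n] steps of
    [A] are enough to resolve all zeros. *)
Lemma return_mx_strict (u : 'rV_m) e s : u != 0 ->
  weakly_alternates (u *m return_mx ^+ n) e s -> alternates u e s.
Proof.
move=> u0 [X [Xm Xp]]; apply/alternates_ext.
have pn : (n <= p * n + 0)%N by rewrite addn0 leq_pmull // /p; lia.
apply: (weak_chain_strict hk hb pn (@on_class_incl u)).
  by apply: ext_neq0; apply: contraNneq u0 => /class_incl_inj ->.
apply: (weak_chain_iter hb hk hA (fun t => return_orbit_neq0 t u0) (@on_class_incl u)).
rewrite -return_mx_iter.
apply: (weak_chain0 hk hb (X := fun j => (q + X j * p)%N%:Z)) => j js.
  by have := Xm _ js; rewrite /p; nia.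
split; last by rewrite ext_class; exact: Xp.
  by have := class_pos_lt (X j); lia.
by exists ((X j : nat)%:Z - n%:Z * k%:Z); rewrite /p; nia.
Qed.

Lemma return_mx_spectrum : exists rs : seq R,
  [/\ uniq rs, all (fun a => 0 < a) rs
    & char_poly return_mx = \prod_(a <- rs) ('X - a%:P)].
Proof.
apply: (@char_poly_simple_positive _ _ _ n) return_mx_vd return_mx_strict return_mx_inj.
by rewrite /n /m /p; lia.
Qed.

End ReturnMap.

(** * The coprime case *)

Lemma graded_poly (F : fieldType) (f : {poly F}) p m q : (q < p)%N ->
  f \is monic -> size f = (m * p + q).+1 ->
  (forall i, f`_i != 0 -> i = m * p + q %[mod p]) ->
  exists Q : {poly F}, [/\ Q \is monic, size Q = m.+1 & f = 'X^q * (Q \Po 'X^p)].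
Proof.
move=> qp fmon fsize fgr; have p0 : (0 < p)%N by exact: leq_ltn_trans qp.
pose Q := \poly_(i < m.+1) f`_(q + i * p).
have fm : f`_(q + m * p) = 1.
  by move/monicP: fmon; rewrite lead_coefE fsize addnC.
have sQ : size Q = m.+1 by rewrite size_poly_eq // fm oner_neq0.
exists Q; split=> //.
  by rewrite monicE lead_coefE sQ coef_poly ltnSn fm.
apply/polyP => i; rewrite coefXnM coef_comp_poly_Xn //.
have [fi0|fi0] := eqVneq f`_i 0.
  case: ltnP => // qi; case: ifP => // /dvdnP[j jE].
  rewrite jE mulnK // coef_poly; case: ltnP => // _.
  by rewrite -jE subnKC.
have := fgr _ fi0; rewrite modnMDl (modn_small qp) => iq.
have iE := divn_eq i p; rewrite iq in iE.
have -> : (i < q)%N = false by apply/negbTE; rewrite -leqNgt iE leq_addl.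
rewrite {2 3}iE addnK dvdn_mull // mulnK // coef_poly.
have ilt : (i < size f)%N by rewrite ltnNge; apply: contra fi0 => /leq_sizeP->.
rewrite fsize in ilt; have -> : (i %/ p < m.+1)%N.
  rewrite ltnS -(leq_pmul2r p0) -(leq_add2r q) -iE; exact: ilt.
by rewrite addnC -iE.
Qed.

Lemma positive_roots (R : realType) p (l : seq R) : (0 < p)%N -> all (fun a => 0 < a) l ->
  exists2 rs, all (fun a => 0 < a) rs & [seq r ^+ p | r <- rs] = l.
Proof.
move=> p0; elim: l => [|a l IH] /=; first by exists [::].
move=> /andP[/(positive_root p0)[r r0 <-] /IH[rs rs0 <-]].
by exists (r :: rs); rewrite //= r0.
Qed.

Section Coprime.
Variables (R : realType) (b k : nat).
Hypotheses (hb : (0 < b)%N) (hk : (0 < k)%N) (cbk : coprime b k).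
Let p := (b + k)%N.
Let w := unity_rot R p 1.

Let p_gt0 : (0 < p)%N.
Proof. by rewrite /p; lia. Qed.

(** The Bezout coefficient [c] of [b] modulo [p] makes [w ^+ (c * i)] gain a
    factor [w] along each edge, both for [b] and for [- k]. *)
Lemma double_band_graded n (A : 'M[R]_n) : double_band b k A ->
  forall i, (char_poly (map_mx (real_complex R) A))`_i != 0 -> i = n %[mod p].
Proof.
move=> hA; have wp : p.-primitive_root w by exact: unity_rot_prim.
have [c d cd _] := egcdnP p hb.
have cp : gcdn b p = 1%N by rewrite /p gcdnDl; apply/eqP.
rewrite cp in cd.
have wc : w ^+ (c * b) = w.
  by rewrite cd exprD mulnC exprM (prim_expr_order wp) expr1n mul1r.
have wk : w * w ^+ (c * k) = 1.
  by rewrite -[X in X * _]wc -exprD -mulnDr mulnC exprM (prim_expr_order wp) expr1n.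
apply: (@char_poly_graded _ _ _ _ w (fun i => c * i)%N wp) => i j.
rewrite mxE => Aij; have [h1 h2] := hA i j.
have [E|nE] := eqVneq (i%:Z - j%:Z) b%:Z.
  have -> : i = (j + b)%N :> nat by lia.
  by rewrite mulnDr exprD wc mulrC.
have [E|nE'] := eqVneq (i%:Z - j%:Z) (- k%:Z).
  have -> : j = (i + k)%N :> nat by lia.
  by rewrite mulnDr exprD mulrCA wk mulr1.
by move: Aij; rewrite h2 ?eqxx // => -[] /eqP; rewrite ?(negPf nE) ?(negPf nE').
Qed.

Lemma coprime_char_poly m q (n := (m * p + q)%N) (A : 'M[R]_n) :
  (q < p)%N -> double_band b k A ->
  exists rs : seq R, [/\ size rs = m, uniq rs, all (fun r => 0 < r) rs &
    char_poly (map_mx (real_complex R) A) =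
      'X^q * \prod_(c <- [seq r%:C * unity_rot R p j | r <- rs, j <- iota 0 p])
               ('X - c%:P)].
Proof.
move=> qp hA; set chi := char_poly _.
have wp : p.-primitive_root w by exact: unity_rot_prim.
have [Q [Qmon Qsize chiE]] := graded_poly qp (char_poly_monic _ : chi \is monic)
   (size_char_poly _) (double_band_graded hA).
have [rs [rsize runiq rpos rroot]] : exists rs : seq R,
   [/\ size rs = m, uniq [seq r ^+ p | r <- rs], all (fun r => 0 < r) rs
     & forall r, r \in rs -> root Q (r%:C ^+ p)].
  case: m @n A hA @chi Qsize chiE => [|m'] n A hA chi Qsize chiE; first by exists [::].
  have [l [luniq lpos lE]] := return_mx_spectrum hb hk qp hA.
  have lsize : size l = m'.+1.
    by apply: succn_inj; rewrite -(size_prod_XsubC _ id) -lE size_char_poly.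
  have [rs rpos rsE] := positive_roots p_gt0 lpos.
  exists rs; split=> //; first by rewrite -lsize -rsE size_map.
    by rewrite rsE.
  move=> r rin; have r0 := allP rpos _ rin.
  have : root (char_poly (return_mx hb hk qp A)) (r ^+ p).
    by rewrite lE root_prod_XsubC -rsE (map_f (fun r => r ^+ p) rin).
  rewrite -eigenvalue_root_char => /eigenvalueP[u uM u0].
  pose v := u *m class_incl R m' hb hk qp.
  have v0 : v != 0 by apply: contraNneq u0 => /class_incl_inj ->.
  have vA : v *m A ^+ p = r ^+ p *: v.
    by rewrite /v -(return_mxE hb hk qp hA) uM scalemxAl.
  have rC0 : r%:C != 0 by rewrite (inj_eq (@complexI R) r 0) gt_eqF.
  have vC0 : map_mx (real_complex R) v != 0 by rewrite map_mx_eq0.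
  have vCA : map_mx (real_complex R) v *m map_mx (real_complex R) A ^+ p =
     r%:C ^+ p *: map_mx (real_complex R) v.
    rewrite -(rmorphXn (real_complex R)) -map_mxZ -vA [RHS]map_mxM.
    by rewrite (rmorphXn (map_mx (real_complex R))).
  have [c cin croot] := eigen_pow_root vC0 vCA (prod_rotations wp rC0).
  have [j _ cE] := mapP cin.
  have cp : c ^+ p = r%:C ^+ p.
    by rewrite cE exprMn -exprM mulnC exprM (prim_expr_order wp) expr1n mulr1.
  have c0 : c != 0.
    by apply: contraNneq (expf_neq0 p rC0) => c0; rewrite -cp c0 expr0n gtn_eqF.
  move: croot; rewrite -/chi chiE rootM !rootE horner_comp !hornerE.
  by rewrite expf_eq0 (negPf c0) andbF /= cp.
exists rs; split=> //; first exact: map_uniq runiq.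
rewrite [chi]chiE; congr (_ * _).
have -> : Q = \prod_(r <- rs) ('X - (r%:C ^+ p)%:P).
  have -> : \prod_(r <- rs) ('X - (r%:C ^+ p)%:P) =
      \prod_(a <- [seq r%:C ^+ p | r <- rs]) ('X - a%:P) by rewrite big_map.
  rewrite [LHS](@all_roots_prod_XsubC _ _ [seq r%:C ^+ p | r <- rs]).
  - by rewrite (monicP Qmon) scale1r.
  - by rewrite Qsize size_map rsize.
  - by apply/allP => _ /mapP[r /rroot h ->].
  rewrite uniq_rootsE (eq_map (g := fun r => (r ^+ p)%:C)).
    by rewrite map_comp map_inj_uniq //; exact: complexI.
  by move=> r; rewrite rmorphXn.
rewrite rmorph_prod /= big_flatten /= big_map big_seq [RHS]big_seq.
apply: eq_bigr => r rin.
rewrite comp_polyB comp_polyX comp_polyC (prod_rotations wp).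
  by rewrite !big_map; apply: eq_bigr => j _; rewrite -unity_rotE.
by rewrite (inj_eq (@complexI R) r 0) gt_eqF // (allP rpos).
Qed.

End Coprime.

(** * Splitting into residue classes *)

Lemma det_castmx (S : comNzRingType) m n (e : m = n) (B : 'M[S]_m) :
  \det (castmx (e, e) B) = \det B.
Proof. by case: _ / e; rewrite castmx_id. Qed.

Lemma det_mxdiag (S : comNzRingType) m (s_ : 'I_m -> nat)
    (B_ : forall i, 'M[S]_(s_ i)) :
  \det (\mxdiag_i B_ i) = \prod_i \det (B_ i).
Proof.
elim: m s_ B_ => [|m IH] s_ B_.
  have det_empty N (B : 'M[S]_N) : N = 0%N -> \det B = 1.
    by move=> N0; move: B; rewrite N0 => B; exact: det_mx00.
  by rewrite [RHS]big_ord0; apply: det_empty; rewrite big_ord0.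
by rewrite mxdiag_recl det_castmx det_ublock IH big_ord_recl.
Qed.

Lemma det_reindex (S : comNzRingType) m n (f : 'I_m -> 'I_n) (B : 'M[S]_n) :
  bijective f -> \det (mxsub f f B) = \det B.
Proof.
move=> fbij; have mn : m = n by have := bij_eq_card fbij; rewrite !card_ord.
case: _ / mn in B f fbij *.
have finj := bij_inj fbij.
have -> : mxsub f f B = row_perm (perm finj) (col_perm (perm finj) B).
  by apply/matrixP => i j; rewrite !mxE !permE.
rewrite row_permE col_permE !det_mulmx !det_perm odd_permV.
by rewrite mulrCA -signr_addb addbb mulr1.
Qed.

Section Residues.
Variables (n g : nat).
Hypothesis g_gt0 : (0 < g)%N.

(** The number of [i < n] congruent to [t] modulo [g], for [t < g]. *)
Definition residue_size t := ((n + g - t.+1) %/ g)%N.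

Lemma residue_pos_lt t (x : 'I_(residue_size t)) : (t + x * g < n)%N.
Proof.
by have := ltn_ord x; rewrite /residue_size leq_divRL // mulSn; lia.
Qed.

Definition residue_pos t x : 'I_n := Ordinal (@residue_pos_lt t x).

Lemma residue_posP (i : 'I_n) (t := (i %% g)%N) :
  exists x : 'I_(residue_size t), i = residue_pos x.
Proof.
have ig := divn_eq i g; have tg : (t < g)%N by rewrite ltn_mod.
have xlt : (i %/ g < residue_size t)%N.
  rewrite leq_divRL // mulSn; have := ltn_ord i; rewrite -/t in ig; lia.
by exists (Ordinal xlt); apply: val_inj; rewrite /= addnC.
Qed.

Definition residue_block (T : Type) (B : 'M[T]_n) t : 'M[T]_(residue_size t) :=
  mxsub (@residue_pos t) (@residue_pos t) B.

(* The indices listed residue class by residue class. *)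
Let flat (s : 'I_(\sum_(t < g) residue_size t)) : 'I_n :=
  residue_pos (tagged (tagnat.sig s)).

Lemma flat_bij : bijective flat.
Proof.
have flat_inj : injective flat.
  move=> s s' /(congr1 val) /= E; apply: tagnat.sig_inj.
  move: E; case: (tagnat.sig s) (tagnat.sig s') => [t x] [t' x'] /= E.
  have tt' : t = t'.
    apply: val_inj => /=; have /(congr1 (modn^~ g)) := E.
    by rewrite ![(_ + _ * g)%N]addnC !modnMDl !modn_small.
  case: _ / tt' in x' E *; congr Tagged; apply: val_inj => /=.
  by move/addnI/eqP: E; rewrite eqn_pmul2r // => /eqP.
pose back (i : 'I_n) := tagnat.rank (Tagged (fun t : 'I_g => 'I_(residue_size t))
  (sval (cid (residue_posP i)) : 'I_(residue_size (Ordinal (ltn_pmod i g_gt0))))).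
have backK : cancel back flat.
  move=> i; rewrite /flat /back tagnat.rankK /=.
  by case: cid => x /= <-.
by exists back => // s; apply: flat_inj; rewrite backK.
Qed.

Lemma det_residue (S : comNzRingType) (B : 'M[S]_n) :
  (forall i j : 'I_n, B i j != 0 -> i = j %[mod g]) ->
  \det B = \prod_(t < g) \det (residue_block B t).
Proof.
move=> hB; rewrite -(det_reindex _ flat_bij) -det_mxdiag; congr (\det _).
apply/matrixP => s s'; rewrite !mxE /flat /tagnat.sig1 /tagnat.sig2.
case: (tagnat.sig s) (tagnat.sig s') => [t x] [t' x'] /=.
case: eqVneq => [tt'|tt'].
  by case: _ / tt' in x' *; rewrite conform_mx_id mxE.
rewrite mxE; apply/eqP; apply: contraNT tt' => /hB /=.
rewrite ![(_ + _ * g)%N]addnC !modnMDl !modn_small // => E.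
by apply/eqP/val_inj.
Qed.

Lemma char_poly_residue (S : comNzRingType) (A : 'M[S]_n) :
  (forall i j : 'I_n, A i j != 0 -> i = j %[mod g]) ->
  char_poly A = \prod_(t < g) char_poly (residue_block A t).
Proof.
move=> hA; rewrite /char_poly det_residue => [|i j].
  apply: eq_bigr => t _; congr (\det _); apply/matrixP => x y; rewrite !mxE.
  by rewrite -val_eqE /= eqn_add2l eqn_pmul2r.
rewrite !mxE; have [-> //|ij] := eqVneq i j.
by rewrite mulr0n sub0r oppr_eq0 polyC_eq0 => /hA.
Qed.

End Residues.

(** * Counting eigenvalues *)

Lemma residue_block_double_band (R : realType) b k n g (g_gt0 : (0 < g)%N)
    (A : 'M[R]_n) t :
  double_band (g * b) (g * k) A -> double_band b k (residue_block g_gt0 A t).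
Proof.
move=> hA x y; have [h1 h2] := hA (residue_pos g_gt0 x) (residue_pos g_gt0 y).
rewrite mxE; move: h1 h2 => /=.
have -> : (t + x * g)%N%:Z - (t + y * g)%N%:Z = g%:Z * (x%:Z - y%:Z) by lia.
have gI : injective ( *%R g%:Z) by apply: mulfI; lia.
rewrite !PoszM -mulrN => h1 h2; split=> [h|h].
  by apply: h1; case: h => ->; [left|right].
by apply: h2 => -[] /gI h'; apply: h; [left|right].
Qed.

Lemma num_moduliE n g p t : (0 < g)%N -> (t < g)%N ->
  num_moduli n g p t.+1 = (residue_size n g t %/ p)%N.
Proof.
move=> g0 tg; rewrite /num_moduli /residue_size.
have -> : n%:Z - t.+1%:Z = (-1) * g%:Z + (n + g - t.+1)%N%:Z by lia.
rewrite divzMDl; last by lia.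
by rewrite addrC addrA subrr add0r !divz_nat absz_nat.
Qed.

Lemma residue_sizeE n g t : (t < g)%N ->
  residue_size n g t = (n %/ g + (t < n %% g))%N.
Proof.
move=> tg; have g0 : (0 < g)%N by exact: leq_ltn_trans tg.
have rg : (n %% g < g)%N by rewrite ltn_mod.
rewrite /residue_size {1}(divn_eq n g) -addnA -addnBA; last by lia.
rewrite divnMDl //; congr (_ + _)%N; case: ltnP => h.
  by rewrite addnC -addnBA // divnDl // divnn g0 divn_small //; lia.
by rewrite divn_small //; lia.
Qed.

Lemma sum_residue_mod n g p : (0 < g)%N ->
  (\sum_(t < g) (residue_size n g t %% p))%N%:Z =
    g%:Z * ((n %/ g) %% p)%N%:Z
    + (n %% g)%N%:Z * (((n %/ g + 1) %% p)%N%:Z - ((n %/ g) %% p)%N%:Z).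
Proof.
move=> g0; have rg : (n %% g <= g)%N by rewrite ltnW // ltn_mod.
have -> : (\sum_(t < g) (residue_size n g t %% p) =
   \sum_(0 <= t < g) (n %/ g + (t < n %% g)) %% p)%N.
  by rewrite big_mkord; apply: eq_bigr => t _; rewrite residue_sizeE.
rewrite (big_cat_nat (n := (n %% g)%N)) //=.
rewrite (eq_big_nat _ _ (F2 := fun=> ((n %/ g + 1) %% p)%N)); last first.
  by move=> i /andP[_ ->].
rewrite [X in (_ + X)%N](eq_big_nat _ _ (F2 := fun=> ((n %/ g) %% p)%N)); last first.
  by move=> i /andP[h _]; rewrite ltnNge h addn0.
by rewrite !sum_nat_const_nat subn0; nia.
Qed.

Lemma coprime_char_poly_nth (R : realType) b k n (A : 'M[R]_n) :
  (0 < b)%N -> (0 < k)%N -> coprime b k -> double_band b k A ->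
  exists r : nat -> R,
  [/\ {in iota 1 (n %/ (b + k)), forall s, 0 < r s},
      {in iota 1 (n %/ (b + k)) &, injective r} &
      char_poly (map_mx (real_complex R) A) =
      'X^(n %% (b + k)) *
      \prod_(c <- [seq (r s)%:C * unity_rot R (b + k) j
                   | s <- iota 1 (n %/ (b + k)), j <- iota 0 (b + k)])
         ('X - c%:P)].
Proof.
move=> hb hk cbk; have p0 : (0 < b + k)%N by lia.
have := divn_eq n (b + k); have := ltn_pmod n p0.
move: (n %/ _)%N (n %% _)%N => m q hq nE; subst n => hA.
have [rs [rsize runiq rpos chiE]] := coprime_char_poly hb hk cbk hq hA.
exists (fun s => rs`_s.-1); split.
- move=> s; rewrite mem_iota => /andP[s0 sm].
  by apply/(allP rpos)/mem_nth; rewrite rsize; lia.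
- move=> s s'; rewrite !mem_iota => hs hs' /eqP.
  by rewrite nth_uniq ?rsize // => [/eqP||]; lia.
rewrite chiE; congr (_ * \prod_(c <- _) _).
have {1}-> : rs = [seq rs`_s.-1 | s <- iota 1 m].
  by rewrite (iotaDl 1 0 m) -map_comp -[LHS](mkseq_nth 0) /mkseq rsize.
by rewrite -map_comp.
Qed.

Lemma spectrum_of_char_poly (R : realType) n (A : 'M[R]_n) q (L : seq R[i]) :
  0 \notin L ->
  char_poly (map_mx (real_complex R) A) = 'X^q * \prod_(c <- L) ('X - c%:P) ->
  alg_mult A 0 = q /\ nonzero_eigenvalues A L.
Proof.
move=> L0 chiE.
have multE z : alg_mult A z = ((if z == 0%R then q else 0) + count_mem z L)%N.
  rewrite /alg_mult chiE mupM; last first.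
  - by rewrite monic_neq0 // monic_prod_XsubC.
  - by rewrite monic_neq0 // monicXn.
  by rewrite mu_prod_XsubC -['X]subr0 mup_XsubCX eq_sym.
split; first by rewrite multE eqxx (count_memPn L0) addn0.
by split=> // z z0; rewrite multE (negPf z0).
Qed.

Lemma rotations_neq0 (R : realType) p m (r : nat -> R) : (0 < p)%N ->
  {in iota 1 m, forall s, 0 < r s} ->
  0 \notin [seq (r s)%:C * unity_rot R p j | s <- iota 1 m, j <- iota 0 p].
Proof.
move=> p0 rpos; apply/negP => /allpairsP[[s j] [/= /rpos rs _]] /esym/eqP.
rewrite mulf_eq0 (inj_eq (@complexI R) (r s) 0) gt_eqF //= unity_rotE.
rewrite expf_eq0 => /andP[_ /eqP w0].
have := prim_expr_order (unity_rot_prim R p0).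
by rewrite w0 expr0n gtn_eqF // => /esym/eqP; rewrite oner_eq0.
Qed.

Theorem theorem1p1 (R : realType) (b k n : nat)
    (hb : (0 < b)%N) (hk : (0 < k)%N) (hn : (0 < n)%N)
    (g p : nat) (hg : g = gcdn b k) (hp : p = ((b + k) %/ g)%N)
    (A : 'M[R]_n) (hA : double_band b k A)
    (m q : nat) (hmq : n = (m * p + q)%N) (hq : (q < p)%N) :
  (g = 1%N ->
     alg_mult A 0 = q /\
     exists r : nat -> R,
       [/\ {in iota 1 m, forall s, 0 < r s},
           {in iota 1 m &, injective r} &
           nonzero_eigenvalues A
             [seq (r s)%:C * unity_rot R p j | s <- iota 1 m, j <- iota 0 p]])
  /\
  ((exists r : nat -> nat -> R,
      [/\ forall t, t \in iota 1 g ->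
            {in iota 1 (num_moduli n g p t), forall s, 0 < r s t},
          forall t, t \in iota 1 g ->
            {in iota 1 (num_moduli n g p t) &, injective (r ^~ t)} &
          nonzero_eigenvalues A
            (flatten
               [seq [seq (r s t)%:C * unity_rot R p j
                      | s <- iota 1 (num_moduli n g p t), j <- iota 0 p]
                | t <- iota 1 g])])
   /\
   (alg_mult A 0)%:Z =
     g%:Z * ((n %/ g) %% p)%N%:Z
     + (n %% g)%N%:Z * (((n %/ g + 1) %% p)%N%:Z - ((n %/ g) %% p)%N%:Z)).
Proof.
have g0 : (0 < g)%N by rewrite hg gcdn_gt0 hb.
have [b' bE] : exists b', b = (g * b')%N.
  by exists (b %/ g)%N; rewrite mulnC divnK // hg dvdn_gcdl.
have [k' kE] : exists k', k = (g * k')%N.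
  by exists (k %/ g)%N; rewrite mulnC divnK // hg dvdn_gcdr.
have b0 : (0 < b')%N by rewrite bE muln_gt0 in hb; case/andP: hb.
have k0 : (0 < k')%N by rewrite kE muln_gt0 in hk; case/andP: hk.
have cop : coprime b' k'.
  move/eqP: hg; rewrite bE kE -muln_gcdr -{1}[g]muln1 eqn_pmul2l // eq_sym.
  by [].
have pE : p = (b' + k')%N by rewrite hp bE kE -mulnDr mulKn.
have p0 : (0 < p)%N by rewrite pE; lia.
clear hp hg; split=> [g1|].
  have hA' : double_band b' k' A by move: hA; rewrite bE kE g1 !mul1n.
  have [r [rpos rinj chiE]] := coprime_char_poly_nth b0 k0 cop hA'.
  have nm : (n %/ p)%N = m by rewrite hmq divnMDl // divn_small // addn0.
  have nq : (n %% p)%N = q by rewrite hmq modnMDl modn_small.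
  rewrite -pE nm nq in rpos rinj chiE.
  have [-> hL] := spectrum_of_char_poly (rotations_neq0 p0 rpos) chiE.
  by split=> //; exists r.
have hA' t : double_band b' k' (residue_block g0 A t).
  by apply: residue_block_double_band; rewrite -bE -kE.
have /choice[r hr] : forall t, exists r : nat -> R, _ :=
  fun t => coprime_char_poly_nth b0 k0 cop (hA' t).
pose L t := [seq (r t s)%:C * unity_rot R p j
             | s <- iota 1 (residue_size n g t %/ p), j <- iota 0 p].
have chiE : char_poly (map_mx (real_complex R) A) =
   'X^(\sum_(t < g) (residue_size n g t %% p)) *
   \prod_(c <- flatten [seq L t | t <- iota 0 g]) ('X - c%:P).
  rewrite (char_poly_residue g0) => [|i j].
    have iotaE : iota 0 g = index_iota 0 g by rewrite /index_iota subn0.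
    rewrite big_flatten big_map iotaE big_mkord -prodrXr -big_split /=.
    apply: eq_bigr => t _; have [_ _] := hr t; rewrite -pE => <-.
    by congr char_poly; apply/matrixP => x y; rewrite !mxE.
  rewrite mxE => Aij; have [_ h] := hA i j.
  have [E|nE] := eqVneq (i%:Z - j%:Z) b%:Z.
    have -> : i = (j + b)%N :> nat by lia.
    by rewrite bE mulnC addnC modnMDl.
  have [E|nE'] := eqVneq (i%:Z - j%:Z) (- k%:Z).
    have -> : j = (i + k)%N :> nat by lia.
    by rewrite kE mulnC addnC modnMDl.
  by move: Aij; rewrite h ?eqxx // => -[] /eqP; rewrite ?(negPf nE) ?(negPf nE').
have L0 : 0 \notin flatten [seq L t | t <- iota 0 g].
  apply/negP => /flatten_mapP[t _]; apply/negP/rotations_neq0 => //.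
  by have [] := hr t; rewrite -pE.
have [zE nzE] := spectrum_of_char_poly L0 chiE.
split; last by rewrite zE sum_residue_mod.
have iotaE t : t \in iota 1 g -> num_moduli n g p t = (residue_size n g t.-1 %/ p)%N.
  by rewrite mem_iota => ht; rewrite -num_moduliE ?prednK //; lia.
exists (fun s t => r t.-1 s); split.
- by move=> t /iotaE->; rewrite pE; have [] := hr t.-1.
- by move=> t /iotaE->; rewrite pE; have [] := hr t.-1.
move: nzE; rewrite (iotaDl 1 0 g) -map_comp; congr (nonzero_eigenvalues _ (flatten _)).
apply/eq_in_map => t tg; rewrite /L /= iotaE //.
by move: tg; rewrite !mem_iota; lia.
Qed.
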